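(* Let $$E_0=\sum_{i=1}^N\frac{C(b_u^i)^2+K(b_w^i)^2+2R\,b_u^ib_w^i}{4\pi}.$$ Then $$\inf_{(U,W)\in L^2(\Omega;\mathbb{R}^2)\times L^2(\Omega;\mathbb{R}^2)}J_0^{(0)}[U,W]=E_0 .$$ Moreover, if $(U_\varepsilon',W_\varepsilon')$ is a minimizer of $J_\varepsilon^{(0)}$, then $$J_\varepsilon^{(0)}[U_\varepsilon',W_\varepsilon']=E_0+o(1)\quad\text{as }\varepsilon\to0 .$$
   Context: $\Omega\subset\mathbb{R}^2$ is bounded, open and simply connected, with Lipschitz boundary. $d_1,\dots,d_N\in\Omega$ ($N\ge1$) are distinct points, and $b_u^i,b_w^i\in\mathbb{R}$ ($i=1,\dots,N$). $C,R,K\in\mathbb{R}$ satisfy $C,K>0$ and $CK>R^2$. $B_\rho(d)=\{z\in\mathbb{R}^2:|z-d|\le\rho\}$. The parameter $\varepsilon$ ranges over $(0,\varepsilon_0)$ with $\varepsilon_0<1$ so small that the balls $B_{\varepsilon_0}(d_i)$ are pairwise disjoint and contained in $\Omega$. $\Omega_\varepsilon=\Omega\setminus\bigcup_{i=1}^N B_\varepsilon(d_i)$. $\nabla\times f=\partial_xf_y-\partial_yf_x$. The set $H_0^\varepsilon$ consists of pairs $(f,g)$ with $f,g\in L^2(\Omega_\varepsilon;\mathbb{R}^2)$, $\nabla\times f=\nabla\times g=0$ in $\Omega_\varepsilon$, and $\int_{\partial B_\varepsilon(d_i)}f\cdot t\,ds=b_u^i$, $\int_{\partial B_\varepsilon(d_i)}g\cdot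 t\,ds=b_w^i$ for all $i$, where $t$ is the counterclockwise unit tangent and $f\cdot t,g\cdot t$ are tangential traces (well defined for $L^2$ curl-free fields). $J_\varepsilon^{(0)}:L^2(\Omega;\mathbb{R}^2)\times L^2(\Omega;\mathbb{R}^2)\to[0,\infty]$ is defined by $$J_\varepsilon^{(0)}[f,g]=\int_{\Omega_\varepsilon}\tfrac12\left(C|f|^2+K|g|^2+2R\,f\cdot g\right)dx\,dy$$ if $(f,g)=\left(|\ln\varepsilon|^{-1/2}\tilde f,\ |\ln\varepsilon|^{-1/2}\tilde g\right)$ on $\Omega_\varepsilon$ for some $(\tilde f,\tilde g)\in H_0^\varepsilon$, and $J_\varepsilon^{(0)}[f,g]=\infty$ otherwise. $J_0^{(0)}:L^2(\Omega;\mathbb{R}^2)\times L^2(\Omega;\mathbb{R}^2)\to[0,\infty]$ is defined by $$J_0^{(0)}[U,W]=\int_\Omega\tfrac12\left(C|\nabla v_u|^2+K|\nabla v_w|^2+2R\,\nabla v_u\cdot\nabla v_w\right)dx\,dy+\sum_{i=1}^N\frac{C(b_u^i)^2+K(b_w^i)^2+2R\,b_u^ib_w^i}{4\pi}$$ if $(U,W)=(\nabla v_u,\nabla v_w)$ for some $v_u,v_w\in H^1(\Omega)$, and $J_0^{(0)}[U,W]=\infty$ otherwise. *)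

(* Defs.v *)
(* The plane is R * R for R : realType, with the product Lebesgue measure. *)
From HB Require Import structures.
From mathcomp Require Import all_boot all_order all_algebra.
From mathcomp Require Import all_classical all_reals all_analysis.
From mathcomp Require Import measurable_realfun.
Set Implicit Arguments.
Unset Strict Implicit.
Unset Printing Implicit Defensive.
Import Order.TTheory GRing.Theory Num.Theory numFieldNormedType.Exports.

Local Open Scope classical_set_scope.
Local Open Scope ring_scope.

Section Plane.
Context {R : realType}.

Definition leb2 := ((@lebesgue_measure R) \x (@lebesgue_measure R))%E.

Definition dot (p q : R * R) : R := p.1 * q.1 + p.2 * q.2.

(* The norm of the library on R * R is the sup norm; disks need this one. *)
Definition enorm (p : R * R) : R := Num.sqrt (dot p p).

Definition disk (c : R * R) (rho : R) : set (R * R) :=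
  [set z | enorm (z - c) <= rho].

Definition path_connected_set (Om : set (R * R)) : Prop :=
  forall p q, Om p -> Om q -> exists gamma : R -> R * R,
    [/\ {within `[0, 1], continuous gamma},
        (forall t : R, t \in `[0, 1] -> Om (gamma t)), gamma 0 = p & gamma 1 = q].

Definition null_homotopic_in (Om : set (R * R)) (gamma : R -> R * R) : Prop :=
  exists H : R * R -> R * R,
    [/\ {within `[0, 1]%classic `*` `[0, 1]%classic, continuous H},
        (forall z : R * R, (`[0, 1]%classic `*` `[0, 1]%classic) z -> Om (H z)),
        (forall t : R, t \in `[0, 1] -> H (0, t) = gamma t /\ H (1, t) = gamma 0) &
        (forall s : R, s \in `[0, 1] -> H (s, 0) = gamma 0 /\ H (s, 1) = gamma 0)].

Definition simply_connected (Om : set (R * R)) : Prop :=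
  path_connected_set Om /\
  forall gamma : R -> R * R, {within `[0, 1], continuous gamma} ->
    (forall t : R, t \in `[0, 1] -> Om (gamma t)) -> gamma 0 = gamma 1 ->
    null_homotopic_in Om gamma.

(* Near every boundary point, Om is the strict epigraph of a Lipschitz function
   in the orthonormal coordinates with axes e and e rotated by pi/2. *)
Definition lipschitz_boundary (Om : set (R * R)) : Prop :=
  forall p : R * R, (closure Om `\` interior Om) p ->
  exists (e : R * R) (r : R) (gamma : R -> R),
    [/\ enorm e = 1, 0 < r, [lipschitz gamma s | s in [set: R]] &
        forall z : R * R, enorm (z - p) < r ->
          (Om z <-> gamma (dot e z) < dot (- e.2, e.1) z)].

Definition dx (f : R * R -> R) : R * R -> R := 'D_(1, 0) f.
Definition dy (f : R * R -> R) : R * R -> R := 'D_(0, 1) f.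

Fixpoint Ck (k : nat) (f : R * R -> R) : Prop :=
  continuous f /\
  (if k is k'.+1 then
     (forall z, derivable f z (1, 0) /\ derivable f z (0, 1)) /\
     Ck k' (dx f) /\ Ck k' (dy f)
   else True).

Definition test_function (Om : set (R * R)) (phi : R * R -> R) : Prop :=
  let supp := closure [set z | phi z != 0] in
  [/\ (forall k, Ck k phi), compact supp & supp `<=` Om].

Definition L2 (D : set (R * R)) (f : R * R -> R) : Prop :=
  measurable_fun D f /\ leb2.-integrable D (fun z => (f z ^+ 2)%:E).

Definition L2v (D : set (R * R)) (f : R * R -> R * R) : Prop :=
  L2 D (fun z => (f z).1) /\ L2 D (fun z => (f z).2).

Definition weak_grad (Om : set (R * R)) (v : R * R -> R) (G : R * R -> R * R)
    : Prop :=
  forall phi, test_function Om phi ->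
    \int[leb2]_(z in Om) (v z * dx phi z)
      = - (\int[leb2]_(z in Om) ((G z).1 * phi z)) /\
    \int[leb2]_(z in Om) (v z * dy phi z)
      = - (\int[leb2]_(z in Om) ((G z).2 * phi z)).

Definition H1 (Om : set (R * R)) (v : R * R -> R) : Prop :=
  L2 Om v /\ exists2 G, L2v Om G & weak_grad Om v G.

(* dx f_y - dy f_x = 0 in the sense of distributions on D *)
Definition curl_free (D : set (R * R)) (f : R * R -> R * R) : Prop :=
  forall phi, test_function D phi ->
    \int[leb2]_(z in D) ((f z).2 * dx phi z - (f z).1 * dy phi z) = 0.

Definition perforated (N : nat) (Om : set (R * R)) (d : 'I_N -> R * R)
    (eps : R) : set (R * R) :=
  Om `\` \bigcup_i disk (d i) eps.

(* The integral of f . t over the i-th circle of radius eps, t counterclockwise.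
   For a curl-free L2 field the tangential trace is the functional given by
   Green's formula: if phi is smooth and vanishes on the boundary of Om, then
   the sum over j of the pairings of f . t with phi on the circles around d j is
     int_(perforated) (f_x dy phi - f_y dx phi)
   and it depends on phi only through its boundary values.  Here these are 1 on
   the i-th circle and 0 on the others (phi is extended by constants to the
   disks, which lie outside the domain of integration). *)
Definition circulation (N : nat) (Om : set (R * R)) (d : 'I_N -> R * R)
    (eps : R) (f : R * R -> R * R) (i : 'I_N) (b : R) : Prop :=
  forall phi, test_function Om phi ->
    (forall j z, disk (d j) eps z -> phi z = (i == j)%:R) ->
    \int[leb2]_(z in perforated Om d eps)
      ((f z).1 * dy phi z - (f z).2 * dx phi z) = b.

Definition H0eps (N : nat) (Om : set (R * R)) (d : 'I_N -> R * R)
    (bu bw : 'I_N -> R) (eps : R) (f g : R * R -> R * R) : Prop :=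
  let Ome := perforated Om d eps in
  [/\ L2v Ome f /\ L2v Ome g, curl_free Ome f /\ curl_free Ome g,
      forall i, circulation Om d eps f i (bu i) &
      forall i, circulation Om d eps g i (bw i)].

(* The elastic moduli are C, K and Rc (usually written R). *)
Definition energy (C K Rc : R) (D : set (R * R)) (f g : R * R -> R * R)
    : \bar R :=
  (\int[leb2]_(z in D)
     (2^-1 * (C * enorm (f z) ^+ 2 + K * enorm (g z) ^+ 2
              + 2 * Rc * dot (f z) (g z)))%:E)%E.

Definition core_energy (C K Rc : R) (N : nat) (bu bw : 'I_N -> R) : R :=
  \sum_(i < N)
    (C * bu i ^+ 2 + K * bw i ^+ 2 + 2 * Rc * bu i * bw i) / (4 * pi).

Definition Jeps (C K Rc : R) (N : nat) (Om : set (R * R)) (d : 'I_N -> R * R)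
    (bu bw : 'I_N -> R) (eps : R) (f g : R * R -> R * R) : \bar R :=
  let Ome := perforated Om d eps in
  let s := (Num.sqrt `|ln eps|)^-1 in
  if `[< exists ft gt, [/\ H0eps Om d bu bw eps ft gt,
           f = (fun z => s *: ft z) %[ae leb2 in Ome] &
           g = (fun z => s *: gt z) %[ae leb2 in Ome]] >]
  then energy C K Rc Ome f g else +oo%E.

(* weak_grad Om v U says that U is the gradient of v, so U and W are the
   gradients appearing in the integral. *)
Definition J0 (C K Rc : R) (N : nat) (Om : set (R * R)) (bu bw : 'I_N -> R)
    (U W : R * R -> R * R) : \bar R :=
  if `[< exists vu vw, [/\ H1 Om vu, H1 Om vw,
           weak_grad Om vu U & weak_grad Om vw W] >]
  then (energy C K Rc Om U W + (core_energy C K Rc bu bw)%:E)%E else +oo%E.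

Definition is_minimizer (Om : set (R * R))
    (J : (R * R -> R * R) -> (R * R -> R * R) -> \bar R)
    (U W : R * R -> R * R) : Prop :=
  [/\ L2v Om U, L2v Om W &
      forall U' W', L2v Om U' -> L2v Om W' -> (J U W <= J U' W')%E].

End Plane.

(* Main.v *)
Require Import Defs.
From HB Require Import structures.
From mathcomp Require Import all_boot all_order all_algebra.
From mathcomp Require Import all_classical all_reals all_analysis.
From mathcomp Require Import measurable_realfun ring lra.
Set Implicit Arguments.
Unset Strict Implicit.
Unset Printing Implicit Defensive.
Import Order.TTheory GRing.Theory Num.Theory numFieldNormedType.Exports.
Local Open Scope classical_set_scope.
Local Open Scope ring_scope.

(** Write q i = C (bu i)^2 + K (bw i)^2 + 2 Rc (bu i) (bw i) for the value of the
    elastic form at the i-th pair of circulations, so that the core energy E0 is the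
    sum of the q i / (4 pi).

    The form is positive definite because Rc^2 < C K. Hence J0 >= E0, with equality
    for the gradients of constants (inf_J0).

    The value of Jeps at a minimizer is its infimum m eps, so that the remainder can
    be o eps = m eps - E0 for all minimizers at once, and it remains to prove that
    m eps tends to E0 (inf_Jeps_cvg). Since the fields are rescaled by
    |ln eps|^(-1/2), this means that the least energy on the perforated domain under
    the circulation constraints is E0 |ln eps| up to an error o(|ln eps|).

    The upper bound comes from the superposition of the vortices
    (z - d i)^perp / |z - d i|^2 with weights bu i / (2 pi) and bw i / (2 pi). Near
    one vortex all the others are bounded, so the energy is almost the sum of the
    energies of the single vortices, each of which is computed from
    the integral 2 pi ln (M / eps) of 1 / |z - d i|^2 over a ring (energy_upper).
    That the superposition is curl free with the right circulations, in the weak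
    sense of the definitions, follows from the divergence theorem for the point source
    (z - d) / |z - d|^2 (flux_cst_disk, H0eps_superposition).

    The lower bound is by duality. Let w be minus the derivative of a function of s
    which is 1 for s <= eps^2 and 0 for s >= eps0^2. Testing the circulation of f
    around d i with that function at s = |z - d i|^2 says that the integral of
    w (|z - d i|^2) f . (z - d i)^perp is bu i / 2. The tangent inequality for the
    form at the trial field proportional to w (|z - d i|^2) (z - d i)^perp then
    bounds the energy below (energy_density_azimuthal). Were w the logarithmic weight
    1 / (2 s ln (eps0 / eps)), the result would be exactly E0 ln (eps0 / eps); as test
    functions are smooth, this weight has to be approximated by smooth ones
    (smooth_log_weight, radial_cutoff), and the bound follows in the limit
    (energy_lower, energy_lower_lim).

    All integrals over rings are reduced to the line by the formula
    integral of F (|z - d|^2) = pi times the integral of F over the positive half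
    line (integral_radial), which rests on the area of a disk. *)

(** The plane with the sigma-algebra that carries leb2. *)
Notation plane R := (measurableTypeR R * measurableTypeR R)%type.

HB.instance Definition _ (R : realType) := Measure.copy (@leb2 R)
  ((@lebesgue_measure R) \x (@lebesgue_measure R))%E.

(** * Borel sets of the plane *)

Section Measurability.
Context {R : realType}.

(** The union of the boxes with rational centre and half-width 1 / (n + 1) that
    are contained in an open set is the whole of it. *)
Lemma open_measurable_plane (A : set (R * R)) :
  open A -> measurable (A : set (plane R)).
Proof.
move=> oA.
pose box (k : nat * (rat * rat)) : set (plane R) :=
  `](ratr k.2.1 - k.1.+1%:R^-1)%R, (ratr k.2.1 + k.1.+1%:R^-1)%R[%classic `*`
  `](ratr k.2.2 - k.1.+1%:R^-1)%R, (ratr k.2.2 + k.1.+1%:R^-1)%R[%classic.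
pose F k : set (plane R) := if `[< box k `<=` A >] then box k else set0.
rewrite (_ : (A : set (plane R)) = \bigcup_k F k).
  apply: countable_bigcupT_measurable; first exact: countableP.
  move=> k; rewrite /F; case: asboolP => _; last exact: measurable0.
  by apply: measurableX; exact: measurable_itv.
apply/seteqP; split => [z Az|z [k _]]; last first.
  by rewrite /F; case: asboolP => // + zk => /(_ z zk).
have /nbhs_ballP[e /= e0 eA] : nbhs z A by exact: open_nbhs_nbhs.
have [n ne] : exists n : nat, n.+1%:R^-1 * 2 < e.
  pose n := Num.truncn (2 / e).
  exists n; rewrite -ltr_pdivlMr// -[ltRHS]invrK ltf_pV2 ?posrE// ?invr_gt0 ?divr_gt0//.
  by rewrite invf_div; exact: truncnS_gt.
set r : R := n.+1%:R^-1 in ne *.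
have r0 : 0 < r by rewrite invr_gt0.
have [p /itvP hp] := @rat_in_itvoo R (z.1 - r) (z.1 + r) ltac:(lra).
have [q /itvP hq] := @rat_in_itvoo R (z.2 - r) (z.2 + r) ltac:(lra).
have hp1 : z.1 - r < ratr p < z.1 + r by rewrite !hp.
have hq1 : z.2 - r < ratr q < z.2 + r by rewrite !hq.
exists (n, (p, q)) => //; rewrite /F.
case: asboolP => [_|[]]; rewrite /box/= -/r.
  by split; rewrite /= in_itv/=; lra.
move=> y [/=]; rewrite !in_itv/= => y1 y2; apply: eA.
by split; rewrite /ball /= ltr_norml; lra.
Qed.

Lemma continuous_measurable_plane (f : R * R -> R) :
  continuous f -> measurable_fun [set: plane R] f.
Proof.
move=> cf; apply: (measurability _ (RGenOpens.measurableE R)).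
move=> _ [_ [a [b ->]] <-]; rewrite setTI.
apply: open_measurable_plane; exact: (@open_comp _ _ f).
Qed.

Lemma bounded_set_box (D : set (R * R)) : bounded_set D ->
  exists2 M : R, 0 < M & (forall z, D z -> `|z.1| <= M /\ `|z.2| <= M).
Proof.
move=> [M [Mr hM]]; exists (`|M| + 1); first by rewrite ltr_wpDl.
move=> z Dz; have := hM (`|M| + 1) _ z Dz.
rewrite (le_lt_trans (ler_norm _)) ?ltrDl// => /(_ isT).
by rewrite {1}/Num.norm/= /Num.Def.normr/= ge_max => /andP[].
Qed.

Lemma leb2_box (M : R) : 0 <= M ->
  @leb2 R (`[- M, M]%classic `*` `[- M, M]%classic) = ((2 * M) ^+ 2)%:E.
Proof.
move=> M0; rewrite /leb2 product_measure1E//= !lebesgue_measure_itv/= !lte_fin.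
case: ltP => h; last first.
  by rewrite mule0; have -> : M = 0 by [lra]; rewrite mulr0 expr0n.
by rewrite -EFinD -EFinM; congr EFin; ring.
Qed.

Lemma bounded_leb2_lty (D : set (plane R)) : measurable D ->
  bounded_set (D : set (R * R)) -> (leb2 D < +oo)%E.
Proof.
move=> mD /bounded_set_box[M M0 DM].
apply: (@le_lt_trans _ _ (@leb2 R (`[(- M)%R, M]%classic `*` `[(- M)%R, M]%classic))).
  apply: le_measure; rewrite ?inE//; first exact: measurableX.
  by move=> z /DM[h1 h2]; split => /=; rewrite in_itv/= -ler_norml.
by rewrite leb2_box ?ltW// ltry.
Qed.

End Measurability.

(** * The area of a disk *)

Section Calculus1.
Context {R : realType}.

Lemma is_derive_continuous (F : R -> R) (x df : R) :
  is_derive x 1 F df -> {for x, continuous F}.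
Proof. by move=> h; apply/differentiable_continuous/derivable1_diffP; case: h. Qed.

Lemma FTC_is_derive (f F : R -> R) (a b : R) : a < b ->
  (forall x, a <= x <= b -> is_derive x 1 F (f x)) ->
  {within `[a, b], continuous f} ->
  (\int[@lebesgue_measure R]_(x in `[a, b]) (f x)%:E = (F b - F a)%:E)%E.
Proof.
move=> ab dF cf; rewrite (@continuous_FTC2 _ f F)// -?EFinB//.
- split.
  + by move=> x; rewrite in_itv/= => /andP[/ltW h1 /ltW h2]; case: (dF x _); rewrite ?h1.
  + apply: cvg_at_right_filter.
    by apply: (@is_derive_continuous _ _ (f a)); apply: dF; rewrite lexx ltW.
  + apply: cvg_at_left_filter.
    by apply: (@is_derive_continuous _ _ (f b)); apply: dF; rewrite lexx ltW.
- move=> x; rewrite in_itv/= => /andP[/ltW h1 /ltW h2].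
  by rewrite derive1E; apply: derive_val; apply: dF; rewrite h1.
Qed.

End Calculus1.

Section Area.
Context {R : realType}.

(** The substitution x = c + r sin t turns the integrand into 2 r^2 cos^2 t and
    removes the vertical tangents at the end points. *)
Lemma integral_half_circle (c r : R) : 0 < r ->
  (\int[@lebesgue_measure R]_(x in `[(c - r)%R, (c + r)%R])
     (2 * Num.sqrt (r ^+ 2 - (x - c) ^+ 2))%:E = (pi * r ^+ 2)%:E)%E.
Proof.
move=> r0.
have pi0 := @pi_gt0 R.
pose F t : R := c + r * sin t.
have dF (t : R) : is_derive t 1 F (r * cos t).
  by apply: is_derive_eq; rewrite /GRing.scale/=; ring.
have F'E : F^`()%classic = fun t => r * cos t.
  by apply/funext => t; rewrite derive1E; apply: derive_val; exact: dF.
have cF' : continuous (fun t : R => r * cos t).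
  by move=> t; apply: cvgM; [exact: cvg_cst|exact: continuous_cos].
have cF : continuous F by move=> t; exact: is_derive_continuous (dF t).
have -> : c - r = F (- (pi / 2)) by rewrite /F sinN sin_pihalf mulrN1.
have -> : c + r = F (pi / 2) by rewrite /F sin_pihalf mulr1.
rewrite integration_by_substitution_increasing ?F'E//.
- under eq_integral => t.
    rewrite inE/= in_itv/= => ht.
    have -> : (((fun x => 2 * Num.sqrt (r ^+ 2 - (x - c) ^+ 2)) \o F) *
      (fun t0 : R => r * cos t0)) t = 2 * Num.sqrt (r ^+ 2 - (F t - c) ^+ 2) * (r * cos t) by [].
    have -> : r ^+ 2 - (F t - c) ^+ 2 = (r * cos t) ^+ 2.
      by rewrite /F exprMn cos2sin2; ring.
    rewrite sqrtr_sqr ger0_norm; last by apply: mulr_ge0; [exact: ltW|exact: cos_ge0_pihalf].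
    over.
  pose G (t : R) := r ^+ 2 * (t + sin t * cos t).
  have dG (t : R) : is_derive t 1 G (2 * (r * cos t) * (r * cos t)).
    apply: is_derive_eq; rewrite /GRing.scale/=.
    have := cos2Dsin2 t; set C := cos t; set S := sin t => h.
    have h' : r ^+ 2 * (C ^+ 2 + S ^+ 2) = r ^+ 2 by rewrite h mulr1.
    lra.
  rewrite (@FTC_is_derive _ _ G _ _ _ (fun t _ => dG t)); first last.
  + apply: continuous_subspaceT => t.
    by apply: cvgM; [apply: cvgM; [exact: cvg_cst|exact: cF']|exact: cF'].
  + by lra.
  by rewrite /G sinN sin_pihalf cosN cos_pihalf; congr EFin; field.
- by lra.
- by move=> x y hx hy; rewrite ltrD2l ltr_pM2l// ltr_sin.
- by apply: cvgP; apply: cvg_at_right_filter; exact: cF'.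
- by apply: cvgP; apply: cvg_at_left_filter; exact: cF'.
- split.
  + by move=> x _; case: (dF x).
  + by apply: cvg_at_right_filter; exact: cF.
  + by apply: cvg_at_left_filter; exact: cF.
- apply: continuous_subspaceT => x; apply: cvgM; first exact: cvg_cst.
  apply: (@continuous_comp _ _ _ (fun x : R => r ^+ 2 - (x - c) ^+ 2) Num.sqrt).
    apply: cvgB; first exact: cvg_cst.
    by apply: cvgM; apply: cvgB; [exact: cvg_id|exact: cvg_cst|exact: cvg_id|exact: cvg_cst].
  exact: sqrt_continuous.
Qed.

Definition sqd (d z : R * R) : R := (z.1 - d.1) ^+ 2 + (z.2 - d.2) ^+ 2.

Lemma sqd_ge0 d z : 0 <= sqd d z.
Proof. by rewrite addr_ge0 ?sqr_ge0. Qed.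

Lemma continuous_sqd d : continuous (sqd d).
Proof.
move=> z; rewrite /sqd; apply: cvgD; apply: cvgM; apply: cvgB; (exact: cvg_cst || exact: cvg_fst || exact: cvg_snd).
Qed.

Lemma measurable_sqd d : measurable_fun [set: plane R] (sqd d).
Proof. by apply: continuous_measurable_plane; exact: continuous_sqd. Qed.

(** Cavalieri's principle. The vertical section at x has length
    2 sqrt (s - (x - d.1)^2), also when it is empty, since Num.sqrt is 0 on negative
    numbers. *)
Lemma leb2_sqd_le (d : R * R) (s : R) : 0 <= s ->
  leb2 [set z | sqd d z <= s] = (pi * s)%:E.
Proof.
move=> s0.
pose r := Num.sqrt s.
have r2 : r ^+ 2 = s by rewrite sqr_sqrtr.
have r0 : 0 <= r by rewrite sqrtr_ge0.
have secE (x : R) : (@lebesgue_measure R) (xsection [set z | sqd d z <= s] x) =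
    (2 * Num.sqrt (r ^+ 2 - (x - d.1) ^+ 2))%:E.
  set h := Num.sqrt _; have h0 : 0 <= h by exact: sqrtr_ge0.
  have [hx|hx] := leP ((x - d.1) ^+ 2) s.
    have h2 : h ^+ 2 = s - (x - d.1) ^+ 2 by rewrite sqr_sqrtr ?r2// subr_ge0.
    rewrite (_ : xsection _ x = `[d.2 - h, d.2 + h]%classic).
      rewrite lebesgue_measure_itv/= lte_fin; case: ltP => hh.
        by rewrite -EFinB; congr EFin; ring.
      by rewrite (_ : h = 0) ?mulr0//; lra.
    apply/seteqP; split => y.
      move/xsectionP; rewrite /= /sqd/= in_itv/= => hy.
      have : (y - d.2) ^+ 2 <= h ^+ 2 by lra.
      rewrite -ler_sqrt ?sqr_ge0// !sqrtr_sqr (ger0_norm h0) ler_norml; lra.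
    rewrite /= in_itv/= => hy; apply/xsectionP; rewrite /= /sqd/=.
    have : (y - d.2) ^+ 2 <= h ^+ 2.
      by rewrite -real_normK ?num_real// ler_sqr ?nnegrE// ler_norml; lra.
    lra.
  rewrite (_ : xsection _ x = set0) ?measure0.
    by rewrite /h ler0_sqrtr ?mulr0// r2; lra.
  apply/seteqP; split => y// /xsectionP; rewrite /= /sqd/=.
  by have := sqr_ge0 (y - d.2); lra.
rewrite /leb2 /product_measure1/=; under eq_integral do rewrite secE.
have [r_neq0|r_neq0] := eqVneq r 0.
  rewrite r_neq0 expr0n/= (_ : s = 0) ?mulr0; last by rewrite -r2 r_neq0 expr0n.
  rewrite integral0_eq// => x _; rewrite ler0_sqrtr ?mulr0//.
  by have := sqr_ge0 (x - d.1); lra.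
have rgt0 : 0 < r by rewrite lt_neqAle eq_sym r_neq0.
rewrite -r2 -(integral_half_circle d.1 rgt0) [RHS]integral_mkcond.
apply: eq_integral => x _; rewrite patchE; case: ifPn => //.
rewrite notin_setE/= in_itv/= => hx.
rewrite ler0_sqrtr ?mulr0// subr_le0.
rewrite -[leRHS]real_normK ?num_real// ler_sqr ?nnegrE// ler_normr.
by case: (leP r (x - d.1)) => //= hr; rewrite leNgt; apply/negP => h; apply: hx; apply/andP; split; lra.
Qed.

End Area.

(** * Integrals of radial functions *)

Section Radial.
Context {R : realType}.
Implicit Type d : R * R.

(** The law of |z - d|^2 under the planar Lebesgue measure; the measurability
    proof is part of its structure of measure. *)
Definition sqd_law d : {measure set (measurableTypeR R) -> \bar R} :=
  measure_function_pushforward__canonical__measure_function_Measure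
    (@leb2 R) (measurable_sqd d : @measurable_fun _ _ (plane R) (measurableTypeR R) setT (sqd d)).

Lemma leb2_sqd_leE d (s : R) :
  leb2 [set z | sqd d z <= s] = (pi * Num.max s 0)%:E.
Proof.
have [s0|s0] := ltP s 0; last by rewrite leb2_sqd_le.
rewrite mulr0 (_ : mkset _ = set0) ?measure0//.
by apply/seteqP; split => z //=; have := sqd_ge0 d z; lra.
Qed.

Lemma measurable_sqd_le d (s : R) :
  measurable ([set z | sqd d z <= s] : set (plane R)).
Proof.
have := @measurable_sqd R d measurableT _ (measurable_itv `]-oo, s]).
rewrite setTI (_ : _ @^-1` _ = [set z | sqd d z <= s])//.
Qed.

Lemma leb2_sqd_oc d (a b : R) : a < b ->
  leb2 (sqd d @^-1` `]a, b]) = (pi * (Num.max b 0 - Num.max a 0))%:E.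
Proof.
move=> ab.
have -> : sqd d @^-1` `]a, b]%classic =
    [set z | sqd d z <= b] `\` [set z | sqd d z <= a].
  rewrite eqEsubset; split => z; rewrite /= in_itv/= ltNge.
    by move=> /andP[/negP].
  by move=> [-> /negP ->].
rewrite measureD/=; last 3 first.
- exact: measurable_sqd_le.
- exact: measurable_sqd_le.
- by rewrite leb2_sqd_leE ltry.
rewrite (_ : _ `&` _ = [set z | sqd d z <= a]).
  by rewrite !leb2_sqd_leE -EFinB -mulrBr.
by apply/seteqP; split => z /=; [case|split => //; lra].
Qed.

Let pim1_ge0 : 0 <= (pi : R)^-1. Proof. by rewrite invr_ge0 pi_ge0. Qed.
Let pim1 : {nonneg R} := NngNum pim1_ge0.

(** Divided by pi, the law of |z - d|^2 gives to each half-open interval of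
    nonnegative numbers its length. Adding the Lebesgue measure of the negative half
    line extends this to all half-open intervals, and those determine a measure. *)
Lemma lebesgue_measure_sqd d (A : set (measurableTypeR R)) : measurable A ->
  A `<=` `[0, +oo[%classic ->
  lebesgue_measure A = mscale pim1 (sqd_law d) A.
Proof.
move=> mA A0.
have mneg : measurable (`]-oo, 0[%classic : set (measurableTypeR R)) by exact: measurable_itv.
rewrite (@lebesgue_measure_unique R (measure_add (mscale pim1 (sqd_law d)) (mrestr lebesgue_measure mneg)))//.
  transitivity (mscale pim1 (sqd_law d) A + mrestr lebesgue_measure mneg A)%E.
    exact: measure_addE.
  rewrite [X in (_ + X)%E](_ : _ = 0%E) ?adde0//.
  rewrite /mrestr (_ : A `&` _ = set0) ?measure0//.
  apply/seteqP; split => x //= -[/A0]; rewrite /= !in_itv/= andbT; lra.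
move=> _ [[a b] _ <-] /=.
have [ba|ab] := leP b a.
  by rewrite set_itv_ge ?measure0// bnd_simp -leNgt.
transitivity (mscale pim1 (sqd_law d) `]a, b]%classic +
    mrestr lebesgue_measure mneg `]a, b]%classic)%E; last first.
  by apply/esym; exact: measure_addE.
rewrite /mscale/= /pushforward leb2_sqd_oc// /mrestr.
rewrite (_ : `]a, b]%classic `&` `]-oo, 0[%classic =
    [set` Interval (BRight a) (if b < 0 then BRight b else BLeft 0)]).
  rewrite !lebesgue_measure_itv/= lte_fin ab -EFinM mulrA mulVf ?gt_eqF ?pi_gt0// mul1r.
  case: (ltP b 0) => b0 /=; rewrite lte_fin.
    rewrite ab -!EFinB -EFinD; congr EFin.
    by rewrite !max_r; lra.
  case: (ltP a 0) => a0; rewrite -?EFinB ?adde0 -?EFinD; congr EFin; lra.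
apply/seteqP; split => x /=; rewrite !in_itv/=; case: (ltP b 0) => b0 /=; lra.
Qed.

(** Polar coordinates in the variable s = |z - d|^2: the ring between s and s + ds
    has area pi ds. *)
Lemma integral_radial d (f : R -> \bar R) :
  measurable_fun [set: R] f -> (forall s, 0 <= f s)%E ->
  (\int[leb2]_z f (sqd d z) =
   pi%:E * \int[@lebesgue_measure R]_(s in `[0%R, +oo[) f s)%E.
Proof.
move=> mf f0.
rewrite (eq_measure_integral (mscale pim1 (sqd_law d))); last first.
  by move=> A mA A0; exact: lebesgue_measure_sqd.
rewrite ge0_integral_mscale//; last exact: measurable_funTS.
rewrite muleA -EFinM/= mulfV ?gt_eqF ?pi_gt0// mul1e.
rewrite ge0_integral_pushforward//; last exact: measurable_funTS.
rewrite (_ : _ @^-1` _ = setT)//; last first.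
  by apply/seteqP; split => z //= _; rewrite in_itv/= sqd_ge0.
exact: measurable_sqd.
Qed.

End Radial.

(** * Smooth weights on the line *)

Section Smooth1.
Context {R : realType}.

(** Asking for some derivative, rather than for the derivative operator, lets a
    family closed under differentiation be smooth by one induction on k. *)
Fixpoint smooth1 (k : nat) (f : R -> R) : Prop :=
  continuous f /\
  (if k is k'.+1 then
     exists2 f' : R -> R, (forall x : R, is_derive x 1 f (f' x)) & smooth1 k' f'
   else True).

Lemma is_derive_ge0_le (F f : R -> R) (a b : R) : a <= b ->
  (forall x, a <= x <= b -> is_derive x 1 F (f x)) ->
  (forall x, a <= x <= b -> 0 <= f x) -> F a <= F b.
Proof.
move=> ab dF f0.
have [||x hx] := @MVT_segment _ F f a b ab.
- by move=> x; rewrite in_itv/= => /andP[? ?]; apply: dF; apply/andP; split; exact: ltW.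
- apply: derivable_within_continuous => x; rewrite in_itv/= => hx.
  by case: (dF x hx).
- rewrite -subr_ge0 => ->; apply: mulr_ge0; last by rewrite subr_ge0.
  by apply: f0; move: hx; rewrite in_itv.
Qed.

Lemma is_derive_mul (f g : R -> R) (x f' g' : R) :
  is_derive x 1 f f' -> is_derive x 1 g g' ->
  is_derive x 1 (fun y => f y * g y) (f' * g x + f x * g').
Proof.
move=> df dg; apply: is_derive_eq (is_deriveM df dg) _.
by rewrite /GRing.scale/= addrC (mulrC f').
Qed.

Lemma is_derive_pow (m : nat) (x : R) :
  is_derive x 1 (fun y : R => y ^+ m) (m%:R * x ^+ m.-1).
Proof.
have := is_derive_poly ('X^m) x; rewrite derivXn hornerMn hornerXn mulr_natl.
by rewrite (_ : horner _ = fun y => y ^+ m)//; apply/funext => y; rewrite hornerXn.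
Qed.

(** A smooth cut-off: it vanishes to infinite order where the polynomial v becomes
    nonpositive. The parameters m and P make the family closed under
    differentiation. *)
Definition flat (v : {poly R}) (c : R) (m : nat) (P : {poly R}) (x : R) : R :=
  if 0 < v.[x] then P.[x] * v.[x]^-1 ^+ m * expR (- c * v.[x]^-1) else 0.

(** The inequality 1 + y <= expR y at y = x / n.+1, raised to the power n.+1. *)
Lemma expRN_le (x : R) (n : nat) : 0 < x -> expR (- x) <= (n.+1%:R / x) ^+ n.+1.
Proof.
move=> x0; rewrite expRN -[leRHS]invrK lef_pV2 ?posrE ?expR_gt0//; last first.
  by rewrite invr_gt0 exprn_gt0// divr_gt0.
rewrite -exprVn invf_div.
have -> : expR x = expR (x / n.+1%:R) ^+ n.+1.
  by rewrite -expRM_natl mulrC divfK.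
apply: lerXn2r; rewrite ?nnegrE ?expR_ge0 ?divr_ge0 ?(ltW x0)//.
by apply: le_trans (expR_ge1Dx _); rewrite lerDr ler01.
Qed.

(** The exponential compensates the pole of order m and leaves two powers of v,
    enough for the derivative to vanish on the zero set of v. *)
Lemma flat_bound v (c : R) m P : 0 < c -> forall x,
  `|flat v c m P x| <= (m.+2%:R / c) ^+ m.+2 * `|P.[x]| * v.[x] ^+ 2.
Proof.
move=> c0 x; rewrite /flat; case: ifPn => [v0|_]; last first.
  by rewrite normr0 mulr_ge0 ?sqr_ge0// mulr_ge0// exprn_ge0// divr_ge0 ?ltW.
set y := v.[x] in v0 *.
rewrite !normrM (@ger0_norm _ (expR _)) ?expR_ge0// (@ger0_norm _ (y^-1 ^+ m)); last first.
  by rewrite exprn_ge0// invr_ge0 ltW.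
have h : expR (- c * y^-1) <= (m.+2%:R / (c / y)) ^+ m.+2.
  by rewrite mulNr; apply: expRN_le; rewrite divr_gt0.
apply: (le_trans (ler_wpM2l _ h)).
  by rewrite mulr_ge0// exprn_ge0// invr_ge0 ltW.
rewrite le_eqVlt; apply/orP; left; apply/eqP.
rewrite -addn2 exprD [in RHS]exprD !expr_div_n exprVn.
by field; rewrite !lt0r_neq0 ?exprn_gt0.
Qed.

(** Where v is positive this is the product rule. At a zero x of v the factor
    theorem gives v = w (X - x), so that flat_bound makes the difference quotient
    O(|y - x|). *)
Lemma is_derive_flat v (c : R) m P (x : R) : 0 < c ->
  is_derive x 1 (flat v c m P)
    (flat v c m.+2 (P^`() * v ^+ 2 - m%:R *: (P * v^`() * v) + c *: (P * v^`())) x).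
Proof.
move=> c0.
have [v0|v0|v0] := ltgtP 0 v.[x].
- apply: (@near_eq_is_derive _ _ _ (fun y => P.[y] * v.[y]^-1 ^+ m * expR (- c * v.[y]^-1))).
    have : \forall y \near x, 0 < v.[y].
      exact: (@cvgr_gt _ _ (nbhs x) _ (horner v) v.[x] (@continuous_horner _ v x) 0 v0).
    by apply: filterS => y y0; rewrite /flat y0.
  have dV : is_derive x 1 (fun y => v.[y]^-1) (- v.[x] ^- 2 *: (v^`()).[x]).
    by apply: is_deriveV; rewrite gt_eqF.
  have vx0 : v.[x] != 0 by rewrite gt_eqF.
  have powE : m%:R * v.[x]^-1 ^+ m.-1 = m%:R * v.[x]^-1 ^+ m * v.[x].
    by case: m => [|m]; rewrite ?mul0r// succnK exprS mulrCA -mulrA (mulrC _ v.[x]) mulrA mulrC -!mulrA mulKf.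
  have dVm : is_derive x 1 (fun y => v.[y]^-1 ^+ m) (m%:R * v.[x]^-1 ^+ m * v.[x] * (- v.[x] ^- 2 *: (v^`()).[x])).
    by rewrite -powE; exact: (is_derive1_comp (is_derive_pow m _) dV).
  have dE : is_derive x 1 (fun y => expR (- c * v.[y]^-1)) (expR (- c * v.[x]^-1) * (- c * (- v.[x] ^- 2 *: (v^`()).[x]))).
    by apply: (@is_derive1_comp _ expR (fun y => - c * v.[y]^-1)).
  apply: is_derive_eq (is_derive_mul (is_derive_mul (is_derive_poly P x) dVm) dE) _.
  rewrite /flat v0 !(hornerD, hornerN, hornerZ, hornerM, horner_exp).
  rewrite (_ : v.[x]^-1 ^+ m.+2 = v.[x]^-1 ^+ m * v.[x]^-1 * v.[x]^-1); last by rewrite !exprSr.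
  move: (expR _) (v.[x]^-1 ^+ m) => E W; rewrite /GRing.scale/=.
  by field.
- have vn : \forall y \near x, v.[y] < 0.
    exact: (@cvgr_lt _ _ (nbhs x) _ (horner v) v.[x] (@continuous_horner _ v x) 0 v0).
  apply: (@near_eq_is_derive _ _ _ (cst 0)).
    by apply: filterS vn => y y0; rewrite /flat ltNge (ltW y0).
  by rewrite /flat ltNge (ltW v0); exact: is_derive_cst.
- have [w vE] : exists w : {poly R}, v = w * ('X - x%:P).
    by apply/factor_theorem; rewrite /root -v0.
  apply/is_derive1_caratheodory.
  exists (fun y => flat v c m P y / (y - x)); split.
  + move=> y; rewrite [flat v c m P x]/flat -v0 ltxx subr0.
    have [->|yx] := eqVneq y x; last by rewrite divfK// subr_eq0.
    by rewrite subrr mulr0 /flat -v0 ltxx.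
  + rewrite /prop_for /continuous_at subrr invr0 mulr0.
    pose K := (m.+2%:R / c) ^+ m.+2.
    pose G y : R := K * `|P.[y]| * w.[y] ^+ 2 * `|y - x|.
    have cG : G y @[y --> x] --> 0.
      rewrite [X in _ --> X](_ : 0 = K * `|P.[x]| * w.[x] ^+ 2 * `|x - x|); last by rewrite subrr normr0 mulr0.
      have cw : horner w y @[y --> x] --> w.[x] by exact: continuous_horner.
      apply: cvgM; last by apply: cvg_norm; apply: cvgB; [exact: cvg_id|exact: cvg_cst].
      apply: cvgM; last by apply: cvgM.
      apply: cvgM; first exact: cvg_cst.
      by apply: cvg_norm; exact: continuous_horner.
    apply: (@squeeze_cvgr _ _ _ _ (fun y => - G y) G).
    * near=> y; rewrite -ler_norml normrM normfV.
      have [->|yx] := eqVneq y x.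
        by rewrite /G subrr normr0 invr0 !mulr0.
      rewrite ler_pdivrMr ?normr_gt0 ?subr_eq0//.
      apply: (le_trans (flat_bound v m P c0 y)).
      rewrite /G vE hornerM hornerXsubC (exprMn _ w.[y]) -[(y - x) ^+ 2]real_normK ?num_real//.
      by rewrite -/K expr2 -!mulrA.
    * by rewrite -[X in _ --> X]oppr0; apply: cvgN.
    * exact: cG.
  + by rewrite subrr invr0 mulr0 /flat -v0 ltxx.
Unshelve. all: by end_near.
Qed.

Lemma smooth1_flat v c m P k : 0 < c -> smooth1 k (flat v c m P).
Proof.
move=> c0; elim: k m P => [|k IH] m P; (split; first by
  move=> x; exact: is_derive_continuous (is_derive_flat v m P x c0)) => //.
by exists (flat v c m.+2 (P^`() * v ^+ 2 - m%:R *: (P * v^`() * v) + c *: (P * v^`()))) => // x;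
  exact: is_derive_flat.
Qed.

Lemma smooth1_scale k (c : R) f : smooth1 k f -> smooth1 k (fun x => c * f x).
Proof.
elim: k f => [|k IH] f [cf df]; split => //;
  try by move=> x; apply: cvgM; [exact: cvg_cst|exact: cf].
case: df => f' df sf; exists (fun x => c * f' x); last exact: IH.
by move=> x; have dfx := df x; exact: is_deriveZ.
Qed.

Lemma smooth1_antiderivative (F f : R -> R) : (forall x : R, is_derive x 1 F (f x)) ->
  (forall k, smooth1 k f) -> forall k, smooth1 k F.
Proof.
move=> dF sf [|k]; (split; first by move=> x; exact: is_derive_continuous (dF x)) => //.
by exists f.
Qed.

(** The smooth weight W stays below 1 / x and nevertheless carries almost all the
    mass ln B - ln A of the measure dx / x on the interval from A to B; G is its
    antiderivative. The weight is expR (- c / v) / x, where v is positive exactly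
    between A and B and c is small. *)
Lemma smooth_log_weight (A B eta : R) : 0 < A -> A < B -> 0 < eta < 1 ->
  exists W G : R -> R,
  [/\ forall k, smooth1 k W, forall x, 0 <= W x /\ W x * x <= 1,
      forall x, ~~ (A < x < B) -> W x = 0,
      forall x : R, is_derive x 1 G (W x) &
      [/\ forall x, x <= A -> G x = 0, forall x, B <= x -> G x = G B &
      (1 - eta) * (ln B - ln A) <= G B]].
Proof.
move=> A0 AB /andP[eta0 eta1].
have B0 : 0 < B by exact: lt_trans AB.
pose T := ln B - ln A.
have T0 : 0 < T by rewrite subr_gt0 ltr_ln.
pose h := eta * T / 4.
have h0 : 0 < h by rewrite /h divr_gt0 ?mulr_gt0.
(* the subinterval from A' to B' has logarithmic length (1 - eta / 2) T *)
pose A' := expR (ln A + h); pose B' := expR (ln B - h).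
have AA' : A < A' by rewrite -[ltLHS]lnK ?posrE// ltr_expR ltrDl.
have BB' : B' < B by rewrite -[ltRHS]lnK ?posrE// ltr_expR gtrBl.
have A'B' : A' < B'.
  have : eta * T < T by rewrite gtr_pMl.
  by rewrite ltr_expR (_ : ln B = ln A + T) ?/h; [lra|rewrite addrC subrK].
have A'0 : 0 < A' by exact: expR_gt0.
pose v : {poly R} := 'X ^+ 2 * ('X - A%:P) * (B%:P - 'X).
have vE x : v.[x] = x ^+ 2 * (x - A) * (B - x) by rewrite /v !(hornerM, hornerD, hornerN, hornerX, hornerC, hornerXn).
(* v0 is a lower bound for v between A' and B', where therefore
   expR (- c / v) >= 1 - eta / 2 *)
pose v0 := A' ^+ 2 * (A' - A) * (B - B').
have v00 : 0 < v0 by rewrite !mulr_gt0 ?exprn_gt0 ?subr_gt0.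
pose c := v0 * (eta / 2).
have c0 : 0 < c by rewrite mulr_gt0// divr_gt0.
(* P / v = 1 / x *)
pose P : {poly R} := 'X * ('X - A%:P) * (B%:P - 'X).
have PE x : P.[x] = x * (x - A) * (B - x) by rewrite /P !(hornerM, hornerD, hornerN, hornerX, hornerC).
pose W := flat v c 1 P.
have vpos x : (0 < v.[x]) = (A < x < B).
  rewrite vE; apply/idP/idP => [hx|/andP[h1 h2]]; last first.
    by rewrite !mulr_gt0 ?exprn_gt0 ?subr_gt0// (lt_trans A0).
  have x2 : 0 < x ^+ 2.
    by rewrite lt_neqAle sqr_ge0 andbT eq_sym; apply: contraTneq hx => ->; rewrite !mul0r ltxx.
  move: hx; rewrite -mulrA pmulr_rgt0// => hx.
  have [xA|xA] := ltP A x; have [xB|xB] := ltP x B => //=; exfalso; nra.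
have WE x : A < x < B -> W x = x^-1 * expR (- c / v.[x]).
  move=> hx; have hv := hx; rewrite -vpos in hv; rewrite /W /flat hv; congr (_ * _).
  rewrite PE expr1 vE; case/andP: hx => h1 h2; field.
  by rewrite !subr_eq0 !gt_eqF// (lt_trans A0).
have W0 x : ~~ (A < x < B) -> W x = 0.
  by rewrite -vpos /W /flat => /negbTE ->.
have Wpos x : 0 <= W x /\ W x * x <= 1.
  have [hx|/W0 ->] := boolP (A < x < B); last by rewrite mul0r ler01.
  have x0 : 0 < x by case/andP: hx => h1 _; exact: lt_trans h1.
  rewrite WE//; split; first by rewrite mulr_ge0 ?expR_ge0// invr_ge0 ltW.
  rewrite mulrAC mulVf ?gt_eqF// mul1r -expR0 ler_expR mulNr oppr_le0.
  by rewrite divr_ge0 ?(ltW c0)// ltW// vpos.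
have sW k : smooth1 k W by exact: smooth1_flat.
have cW : continuous W by case: (sW 0).
have dW0 (a b : R) : (@lebesgue_measure R).-integrable `[a, b] (EFin \o W).
  apply: continuous_compact_integrable; first exact: segment_compact.
  exact: continuous_subspaceT.
pose G x : R := \int[@lebesgue_measure R]_(s in `[0, x]) W s.
have GA x : x <= A -> G x = 0.
  move=> xA; rewrite /G /Rintegral integral0_eq// => s.
  rewrite /= in_itv/= => /andP[s0 sx]; rewrite W0// negb_and -leNgt.
  by rewrite (le_trans sx xA).
have dG (x : R) : is_derive x 1 G (W x).
  have [xA|xA] := ltP x A.
    rewrite W0; last by rewrite negb_and -leNgt ltW.
    apply: (@near_eq_is_derive _ _ _ (cst 0)).
    near=> y; rewrite GA//; apply: ltW; near: y.
    exact: lt_nbhsl.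
  have x0 : 0 < x by exact: lt_le_trans xA.
  have [|dGx GE] := @continuous_FTC1_closed R W 0 x (x + 1) _ (dW0 _ _) x0 (cW x).
    by rewrite ltrDl.
  by apply: DeriveDef; [exact: dGx|rewrite -derive1E; exact: GE].
exists W, G; split => //; split => //.
  move=> x Bx; have W0B y : B <= y <= x -> W y = 0.
    by move=> /andP[By _]; rewrite W0// negb_and -!leNgt By orbT.
  apply/eqP; rewrite eq_le -lerN2; apply/andP; split.
    apply: (@is_derive_ge0_le (fun y => - G y) (fun y => - W y)) => // y hy.
    by rewrite W0B// oppr0.
  by apply: is_derive_ge0_le Bx (fun y _ => dG y) _ => y hy; rewrite W0B.
have le1 : G A' - (1 - eta / 2) * ln A' <= G B' - (1 - eta / 2) * ln B'.
  apply: (@is_derive_ge0_le (fun x => G x - (1 - eta / 2) * ln x)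
    (fun x => W x - (1 - eta / 2) * x^-1)) => [|x /andP[h1 h2]|x /andP[h1 h2]].
  - exact: ltW.
  - have dl := @is_derive1_ln R x (lt_le_trans A'0 h1).
    have dGx := dG x.
    exact: (is_deriveB dGx (is_deriveZ (1 - eta / 2) dl)).
  - have x0 : 0 < x by exact: lt_le_trans h1.
    rewrite subr_ge0 WE; last by rewrite (lt_le_trans AA' h1) (le_lt_trans h2 BB').
    rewrite mulrC ler_pM2l ?invr_gt0//.
    apply: (@le_trans _ _ (expR (- (eta / 2)))); first exact: expR_ge1Dx.
    rewrite ler_expR mulNr lerN2 ler_pdivrMr; last first.
      by rewrite vpos (lt_le_trans AA' h1) (le_lt_trans h2 BB').
    rewrite /c mulrC ler_pM2l ?divr_gt0// vE /v0.
    apply: ler_pM; rewrite ?mulr_ge0 ?sqr_ge0 ?subr_ge0 ?(ltW BB') ?(ltW AA') ?(ltW A'0)//.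
    + apply: ler_pM; rewrite ?sqr_ge0 ?subr_ge0 ?(ltW AA')//; last lra.
      by rewrite lerXn2r ?nnegrE ?(ltW A'0) ?(ltW x0).
    + lra.
have GA' : 0 <= G A'.
  by rewrite -(GA A)//; apply: is_derive_ge0_le (ltW AA') (fun x _ => dG x) _ => x _; case: (Wpos x).
have GB' : G B' <= G B.
  by apply: is_derive_ge0_le (ltW BB') (fun x _ => dG x) _ => x _; case: (Wpos x).
have E : ln B' - ln A' = (1 - eta / 2) * T by rewrite !expRK /h /T; field.
have diff (m a b g1 g2 : R) : g1 - m * a <= g2 - m * b -> m * (b - a) <= g2 - g1.
  by clear; lra.
have {}le1 := diff _ _ _ _ _ le1; rewrite E in le1.
have eta2 : 0 <= eta ^+ 2 * T by rewrite mulr_ge0 ?sqr_ge0 ?ltW.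
have final (e t g1 g2 g3 : R) : 0 <= e ^+ 2 * t ->
    (1 - e / 2) * ((1 - e / 2) * t) <= g2 - g1 -> 0 <= g1 -> g2 <= g3 ->
    (1 - e) * t <= g3 by clear; lra.
exact: final eta2 le1 GA' GB'.
Unshelve. all: by end_near.
Qed.

End Smooth1.

(** * Partial derivatives and test functions *)

Section Partials.
Context {R : realType}.
Implicit Types (f g : R * R -> R) (z d : R * R).

(** A partial derivative is a derivative along a line, so the rules of one-variable
    calculus apply to it. *)
Lemma is_derive_dxE f z (df : R) :
  is_derive z (1, 0) f df <-> is_derive z.1 1 (fun t : R => f (t, z.2)) df.
Proof.
have E : (fun h : R => h^-1 *: ((f \o shift z) (h *: (1, 0)) - f z)) =
         (fun h : R => h^-1 *: (((fun t : R => f (t, z.2)) \o shift z.1) (h *: 1) - f (z.1, z.2))).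
  apply/funext => h /=; rewrite -surjective_pairing; congr (_ *: (f _ - _)).
  by rewrite [LHS]surjective_pairing/= scaler0 add0r.
by split=> -[h1 h2]; apply: DeriveDef; move: h1 h2; rewrite /derivable /derive E.
Qed.

Lemma is_derive_dyE f z (df : R) :
  is_derive z (0, 1) f df <-> is_derive z.2 1 (fun t : R => f (z.1, t)) df.
Proof.
have E : (fun h : R => h^-1 *: ((f \o shift z) (h *: (0, 1)) - f z)) =
         (fun h : R => h^-1 *: (((fun t : R => f (z.1, t)) \o shift z.2) (h *: 1) - f (z.1, z.2))).
  apply/funext => h /=; rewrite -surjective_pairing; congr (_ *: (f _ - _)).
  by rewrite [LHS]surjective_pairing/= scaler0 add0r.
by split=> -[h1 h2]; apply: DeriveDef; move: h1 h2; rewrite /derivable /derive E.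
Qed.

Lemma Ck_continuous k f : Ck k f -> continuous f.
Proof. by case: k => [|k] []. Qed.

Lemma CkS k f (fx fy : R * R -> R) : continuous f ->
  (forall z, is_derive z (1, 0) f (fx z)) ->
  (forall z, is_derive z (0, 1) f (fy z)) ->
  Ck k fx -> Ck k fy -> Ck k.+1 f.
Proof.
move=> cf dfx dfy cfx cfy.
have Ex : dx f = fx by apply/funext => z; have [_ <-] := dfx z.
have Ey : dy f = fy by apply/funext => z; have [_ <-] := dfy z.
split; first exact: cf.
rewrite Ex Ey; split; last by split; [exact: cfx|exact: cfy].
by move=> z; split; [have [+ _] := dfx z|have [+ _] := dfy z]; exact: id.
Qed.

Lemma Ck_is_derive k f : Ck k.+1 f ->
  [/\ forall z, is_derive z (1, 0) f (dx f z),
      forall z, is_derive z (0, 1) f (dy f z), Ck k (dx f) & Ck k (dy f)].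
Proof.
move=> [_ [df [fx fy]]]; split; [move=> z|move=> z|exact: fx|exact: fy].
  by apply: DeriveDef; [exact: (df z).1|exact: erefl].
by apply: DeriveDef; [exact: (df z).2|exact: erefl].
Qed.

Lemma Ck_leS k f : Ck k.+1 f -> Ck k f.
Proof.
elim: k f => [|k IH] f; first by case.
by move=> [cf [df [/IH fx /IH fy]]].
Qed.

Lemma Ck_cst k (c : R) : Ck k (cst c).
Proof.
elim: k c => [|k IH] c; first by split; [exact: cst_continuous|].
exact: (CkS (@cst_continuous _ _ c) (fun z => is_derive_cst c z (1, 0))
  (fun z => is_derive_cst c z (0, 1)) (IH 0) (IH 0)).
Qed.

Lemma Ck_add k f g : Ck k f -> Ck k g -> Ck k (fun z => f z + g z).
Proof.
elim: k f g => [|k IH] f g kf kg.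
  by split; [move=> z; apply: cvgD; [exact: (Ck_continuous kf)|exact: (Ck_continuous kg)]|].
have [fx fy kfx kfy] := Ck_is_derive kf; have [gx gy kgx kgy] := Ck_is_derive kg.
have cfg : continuous (fun z => f z + g z).
  by move=> z; apply: cvgD; [exact: (Ck_continuous kf)|exact: (Ck_continuous kg)].
exact: (CkS cfg (fun z => is_deriveD (fx z) (gx z)) (fun z => is_deriveD (fy z) (gy z))
  (IH _ _ kfx kgx) (IH _ _ kfy kgy)).
Qed.

Lemma Ck_mul k f g : Ck k f -> Ck k g -> Ck k (fun z => f z * g z).
Proof.
elim: k f g => [|k IH] f g kf kg.
  by split; [move=> z; apply: cvgM; [exact: (Ck_continuous kf)|exact: (Ck_continuous kg)]|].
have [fx fy kfx kfy] := Ck_is_derive kf; have [gx gy kgx kgy] := Ck_is_derive kg.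
have := Ck_leS kf; have := Ck_leS kg => kg' kf'.
have cfg : continuous (fun z => f z * g z).
  by move=> z; apply: cvgM; [exact: (Ck_continuous kf)|exact: (Ck_continuous kg)].
exact: (CkS cfg (fun z => is_deriveM (fx z) (gx z)) (fun z => is_deriveM (fy z) (gy z))
  (Ck_add (IH _ _ kf' kgx) (IH _ _ kg' kfx)) (Ck_add (IH _ _ kf' kgy) (IH _ _ kg' kfy))).
Qed.

Lemma Ck_fst k : Ck k (fst : R * R -> R).
Proof.
case: k => [|k]; first by split; [move=> z; exact: cvg_fst|].
apply: (@CkS _ _ (cst 1) (cst 0)); [by move=> z; exact: cvg_fst| | |exact: Ck_cst|exact: Ck_cst].
- by move=> z; apply/is_derive_dxE; exact: is_derive_id.
- by move=> z; apply/is_derive_dyE; exact: is_derive_cst.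
Qed.

Lemma Ck_snd k : Ck k (snd : R * R -> R).
Proof.
case: k => [|k]; first by split; [move=> z; exact: cvg_snd|].
apply: (@CkS _ _ (cst 0) (cst 1)); [by move=> z; exact: cvg_snd| | |exact: Ck_cst|exact: Ck_cst].
- by move=> z; apply/is_derive_dxE; exact: is_derive_cst.
- by move=> z; apply/is_derive_dyE; exact: is_derive_id.
Qed.

Lemma is_derive_sqd_x d z : is_derive z (1, 0) (sqd d) (2 * (z.1 - d.1)).
Proof.
apply/is_derive_dxE; rewrite /sqd/=.
by apply: is_derive_eq; rewrite /GRing.scale/=; ring.
Qed.

Lemma is_derive_sqd_y d z : is_derive z (0, 1) (sqd d) (2 * (z.2 - d.2)).
Proof.
apply/is_derive_dyE; rewrite /sqd/=.
by apply: is_derive_eq; rewrite /GRing.scale/=; ring.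
Qed.

Lemma is_derive_comp_x (Phi : R -> R) f z (a b : R) :
  is_derive (f z) 1 Phi a -> is_derive z (1, 0) f b ->
  is_derive z (1, 0) (Phi \o f) (a * b).
Proof.
move=> dP /is_derive_dxE df; apply/is_derive_dxE.
by apply: (@is_derive1_comp _ Phi (fun t => f (t, z.2))); rewrite -?surjective_pairing.
Qed.

Lemma is_derive_comp_y (Phi : R -> R) f z (a b : R) :
  is_derive (f z) 1 Phi a -> is_derive z (0, 1) f b ->
  is_derive z (0, 1) (Phi \o f) (a * b).
Proof.
move=> dP /is_derive_dyE df; apply/is_derive_dyE.
by apply: (@is_derive1_comp _ Phi (fun t => f (z.1, t))); rewrite -?surjective_pairing.
Qed.

(** The partial derivatives of Phi \o sqd d are products of Phi' \o sqd d with
    polynomials, which makes the induction on k work for all Phi at once. *)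
Lemma Ck_comp_sqd k (Phi : R -> R) d : smooth1 k Phi -> Ck k (Phi \o sqd d).
Proof.
elim: k Phi => [|k IH] Phi [cP].
  by split; [move=> z; apply: continuous_comp; [exact: continuous_sqd|exact: cP]|].
move=> [Phi' dPhi sPhi'].
have CkZ (c : R) (i : R * R -> R) : Ck k i -> Ck k (fun z => (Phi' \o sqd d) z * (2 * (i z - c))).
  move=> ki; apply: Ck_mul; first exact: IH.
  apply: Ck_mul; first exact: Ck_cst.
  by apply: Ck_add; [exact: ki|exact: Ck_cst].
have cf : continuous (Phi \o sqd d).
  by move=> z; apply: continuous_comp; [exact: continuous_sqd|exact: cP].
exact: (CkS cf (fun z => is_derive_comp_x (dPhi _) (is_derive_sqd_x d z))
  (fun z => is_derive_comp_y (dPhi _) (is_derive_sqd_y d z))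
  (CkZ d.1 fst (Ck_fst k)) (CkZ d.2 snd (Ck_snd k))).
Qed.

Lemma closed_sqd_le d (B : R) : closed [set z | sqd d z <= B].
Proof.
have -> : [set z | sqd d z <= B] = sqd d @^-1` [set s | s <= B] by [].
by apply: closed_comp; [move=> z _; exact: continuous_sqd|exact: closed_le].
Qed.

Lemma compact_sqd_le d (B : R) : compact [set z | sqd d z <= B].
Proof.
have [B0|B0] := ltP B 0.
  rewrite (_ : mkset _ = set0); first exact: compact0.
  by apply/seteqP; split => z //=; have := sqd_ge0 d z; lra.
apply: (@subclosed_compact _ _ (`[d.1 - (B + 1), d.1 + (B + 1)]%classic `*`
                                `[d.2 - (B + 1), d.2 + (B + 1)]%classic)).
- exact: closed_sqd_le.
- by apply: compact_setX; exact: segment_compact.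
- move=> z /=; rewrite /sqd !in_itv/= => h.
  have := sqr_ge0 (z.1 - d.1); have := sqr_ge0 (z.2 - d.2) => h1 h2.
  have sq (u : R) : u ^+ 2 <= B -> - (B + 1) <= u <= B + 1.
    by move=> hu; apply/andP; split; nra.
  have := sq (z.1 - d.1) ltac:(lra); have := sq (z.2 - d.2) ltac:(lra); lra.
Qed.

Lemma disk_sqd d (rho : R) : 0 <= rho ->
  disk d rho = [set z | sqd d z <= rho ^+ 2].
Proof.
move=> r0; have dE z : dot (z - d) (z - d) = sqd d z.
  by rewrite /dot /sqd !expr2.
apply/seteqP; split => z; rewrite /disk /enorm /= dE => h.
  rewrite -(sqr_sqrtr (sqd_ge0 d z)).
  by rewrite lerXn2r ?nnegrE ?sqrtr_ge0.
by rewrite -(ger0_norm r0) -sqrtr_sqr ler_wsqrtr.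
Qed.

End Partials.

(** * Integration by parts in the plane *)

Section IntegralTools.
Context d (T : measurableType d) (R : realType) (mu : {measure set T -> \bar R}).

Lemma integrable_le_cst (A : set T) (f : T -> R) (c : R) : measurable A ->
  (mu A < +oo)%E -> measurable_fun A f -> (forall x, A x -> `|f x| <= c) ->
  mu.-integrable A (EFin \o f).
Proof.
move=> mA Aoo mf fc; apply: measurable_bounded_integrable => //.
exists c; split; first exact: num_real.
by move=> M cM x Ax; apply: le_trans (fc x Ax) (ltW cM).
Qed.

Lemma integral_support (A B : set T) (f : T -> \bar R) : measurable A -> measurable B ->
  A `<=` B -> (forall x, B x -> ~ A x -> f x = 0%E) ->
  (\int[mu]_(x in B) f x = \int[mu]_(x in A) f x)%E.
Proof.
move=> mA mB AB f0; rewrite [LHS]integral_mkcond [RHS]integral_mkcond.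
apply: eq_integral => x _; rewrite !patchE.
have [Ax|nAx] := pselect (A x).
  by rewrite !mem_set//; exact: AB.
rewrite (memNset nAx); case: ifPn => //; rewrite inE => Bx.
exact: f0.
Qed.

Lemma integrable_support (A B : set T) (f : T -> \bar R) : measurable A -> measurable B ->
  A `<=` B -> (forall x, B x -> ~ A x -> f x = 0%E) ->
  mu.-integrable A f -> mu.-integrable B f.
Proof.
move=> mA mB AB f0 /(integrable_mkcond f mA) h; apply/(integrable_mkcond f mB).
rewrite (_ : f \_ B = f \_ A)//; apply/funext => x; rewrite !patchE.
have [Ax|nAx] := pselect (A x).
  by rewrite !mem_set//; exact: AB.
rewrite (memNset nAx); case: ifPn => //; rewrite inE => Bx.
exact: f0.
Qed.

End IntegralTools.

Section Divergence.
Context {R : realType}.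
Implicit Type z : R * R.

Lemma continuous_pair_l (y : R) : continuous (fun x : R => (x, y)).
Proof.
move=> x; exact: (cvg_pair (F := nbhs x) (G := nbhs x) (H := nbhs y)
  (f := id) (g := cst y) cvg_id (cvg_cst y)).
Qed.

Lemma continuous_pair_r (x : R) : continuous (fun y : R => (x, y)).
Proof.
move=> y; exact: (cvg_pair (F := nbhs y) (G := nbhs x) (H := nbhs y)
  (f := cst x) (g := id) (cvg_cst x) cvg_id).
Qed.

Lemma integral_derivative_compact (F f : R -> R) (M : R) : 0 <= M ->
  (forall t : R, is_derive t 1 F (f t)) -> continuous f ->
  (forall t, M < `|t| -> F t = 0) ->
  (\int[@lebesgue_measure R]_t (f t)%:E = 0)%E.
Proof.
move=> M0 dF cf F0.
have f0 t : M < `|t| -> f t = 0.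
  move=> Mt; have [_ <-] := dF t.
  have d0 : is_derive t 1 F 0.
    apply: (@near_eq_is_derive _ _ _ (cst 0)).
    have : \forall y \near t, M < `|y|.
      exact: (@cvgr_gt _ _ (nbhs t) _ (fun y : R => `|y|) `|t| (@norm_continuous _ _ t) M Mt).
    by apply: filterS => y My; rewrite F0.
  by have [_ ->] := d0.
rewrite (@integral_support _ _ _ _ (`[- (M + 1), M + 1]%classic : set (measurableTypeR R)) setT)//; last first.
  move=> t _ ht; rewrite f0// ltNge; apply/negP => tM; apply: ht.
  by rewrite /= in_itv/= -ler_norml; lra.
rewrite (@FTC_is_derive _ _ F)//; first last.
- exact: continuous_subspaceT.
- lra.
by rewrite !F0 ?subrr// ?normrN ger0_norm; lra.
Qed.

Lemma is_derive_support_x (f g : R * R -> R) (M : R) z :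
  (forall z, is_derive z (1, 0) f (g z)) ->
  (forall z, M < `|z.1| \/ M < `|z.2| -> f z = 0) ->
  M < `|z.1| \/ M < `|z.2| -> g z = 0.
Proof.
move=> df f0 hz.
have /is_derive_dxE[_ <-] := df z.
have d0 : is_derive z.1 1 (fun t : R => f (t, z.2)) 0.
  apply: (@near_eq_is_derive _ _ _ (cst 0)).
  case: hz => hz.
    have : \forall y \near z.1, M < `|y|.
      exact: (@cvgr_gt _ _ (nbhs z.1) _ (fun y : R => `|y|) `|z.1| (@norm_continuous _ _ z.1) M hz).
    by apply: filterS => y My; rewrite f0//; left.
  by near=> y; rewrite f0//; right.
by have [_ ->] := d0.
Unshelve. all: by end_near. Qed.

Lemma is_derive_support_y (f g : R * R -> R) (M : R) z :
  (forall z, is_derive z (0, 1) f (g z)) ->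
  (forall z, M < `|z.1| \/ M < `|z.2| -> f z = 0) ->
  M < `|z.1| \/ M < `|z.2| -> g z = 0.
Proof.
move=> df f0 hz.
have /is_derive_dyE[_ <-] := df z.
have d0 : is_derive z.2 1 (fun t : R => f (z.1, t)) 0.
  apply: (@near_eq_is_derive _ _ _ (cst 0)).
  case: hz => hz.
    by near=> y; rewrite f0//; left.
  have : \forall y \near z.2, M < `|y|.
    exact: (@cvgr_gt _ _ (nbhs z.2) _ (fun y : R => `|y|) `|z.2| (@norm_continuous _ _ z.2) M hz).
  by apply: filterS => y My; rewrite f0//; right.
by have [_ ->] := d0.
Unshelve. all: by end_near. Qed.

Lemma continuous_box_bounded (h : R * R -> R) (M : R) : continuous h ->
  exists c, forall z, `|z.1| <= M /\ `|z.2| <= M -> `|h z| <= c.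
Proof.
move=> ch; pose box : set (R * R) := `[- M, M]%classic `*` `[- M, M]%classic.
have kbox : compact box by apply: compact_setX; exact: segment_compact.
have : bounded_set (h @` box).
  apply: compact_bounded; apply: continuous_compact => //.
  exact: continuous_subspaceT.
move=> [c [cr hc]]; exists (c + 1) => z [h1 h2].
apply: (hc (c + 1)); first by rewrite ltrDl.
by exists z => //; split => /=; rewrite in_itv/= -ler_norml.
Qed.

Lemma integrable_continuous_compact (h : R * R -> R) (M : R) : continuous h -> 0 <= M ->
  (forall z, M < `|z.1| \/ M < `|z.2| -> h z = 0) ->
  leb2.-integrable [set: plane R] (EFin \o h).
Proof.
move=> ch M0 h0; have [c hc] := continuous_box_bounded M ch.
pose box : set (plane R) := `[- M, M]%classic `*` `[- M, M]%classic.
have mbox : measurable box by apply: measurableX; exact: measurable_itv.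
apply: (@integrable_support _ _ _ _ box) => //.
  move=> z _ hz; congr EFin; apply: h0; apply: contrapT => /not_orP[/negP + /negP].
  rewrite -!leNgt => h1 h2; apply: hz.
  by split; rewrite /= in_itv/= -ler_norml.
apply: (integrable_le_cst (c := c)) => //.
- by have := ltry ((2 * M) ^+ 2); rewrite -(leb2_box M0).
- by apply: measurable_funTS; exact: continuous_measurable_plane.
- by move=> z [/= h1 h2]; apply: hc; move: h1 h2; rewrite !in_itv/= -!ler_norml.
Qed.

(** By Fubini it suffices that the derivative of a compactly supported function
    has integral 0 on each horizontal line. *)
Lemma integral_dx_compact (f g : R * R -> R) (M : R) : 0 <= M -> continuous g ->
  (forall z, is_derive z (1, 0) f (g z)) ->
  (forall z, M < `|z.1| \/ M < `|z.2| -> f z = 0) ->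
  leb2.-integrable [set: plane R] (EFin \o g) /\
  (\int[leb2]_z (g z)%:E = 0)%E.
Proof.
move=> M0 cg df f0; have g0 z := is_derive_support_x (z := z) df f0.
have ig := integrable_continuous_compact cg M0 g0; split=> //.
rewrite /leb2 -(integral21_prod_meas1 ig)/=.
apply: integral0_eq => y _; rewrite /fubini_G/=.
apply: (@integral_derivative_compact (fun x => f (x, y)) _ M M0).
- by move=> x; apply/(is_derive_dxE f (x, y)).
- by move=> x; apply: continuous_comp; [exact: continuous_pair_l|exact: cg].
- by move=> x Mx; apply: f0; left.
Qed.

Lemma integral_dy_compact (f g : R * R -> R) (M : R) : 0 <= M -> continuous g ->
  (forall z, is_derive z (0, 1) f (g z)) ->
  (forall z, M < `|z.1| \/ M < `|z.2| -> f z = 0) ->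
  leb2.-integrable [set: plane R] (EFin \o g) /\
  (\int[leb2]_z (g z)%:E = 0)%E.
Proof.
move=> M0 cg df f0; have g0 z := is_derive_support_y (z := z) df f0.
have ig := integrable_continuous_compact cg M0 g0; split=> //.
rewrite /leb2 -(integral12_prod_meas1 ig)/=.
apply: integral0_eq => x _; rewrite /fubini_F/=.
apply: (@integral_derivative_compact (fun y => f (x, y)) _ M M0).
- by move=> y; apply/(is_derive_dyE f (x, y)).
- by move=> y; apply: continuous_comp; [exact: continuous_pair_r|exact: cg].
- by move=> y My; apply: f0; right.
Qed.

End Divergence.

(** * Radial test functions and the flux of a point source *)

Section Cutoff.
Context {R : realType}.
Implicit Types (z d : R * R).

(** The radial test functions used throughout. Between A and B the profile Phi
    falls from 1 to 0 nearly like an affine function of ln s, which is the extremal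
    profile for the capacity of an annulus: the bound on w s * s, where w is minus the
    derivative of Phi, would be attained by that function for eta = 0. *)
Lemma radial_cutoff (A B eta : R) : 0 < A -> A < B -> 0 < eta < 1 ->
  exists Phi w : R -> R, [/\
   forall (Om : set (R * R)) d, [set z | sqd d z <= B] `<=` Om ->
     test_function Om (Phi \o sqd d),
   (forall s, s <= A -> Phi s = 1) /\ (forall s, B <= s -> Phi s = 0),
   forall d z, dx (Phi \o sqd d) z = - w (sqd d z) * (2 * (z.1 - d.1)) /\
               dy (Phi \o sqd d) z = - w (sqd d z) * (2 * (z.2 - d.2)),
   [/\ continuous w, forall s, 0 <= w s,
       forall s, w s * s <= ((1 - eta) * (ln B - ln A))^-1 &
       forall s, ~~ (A < s < B) -> w s = 0] &
   (\int[@lebesgue_measure R]_(s in `[0%R, +oo[) (w s)%:E = 1)%E].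
Proof.
move=> A0 AB eta01.
have [W [G [sW Wpos W0 dG [GA GB Gge]]]] := smooth_log_weight A0 AB eta01.
pose T := (1 - eta) * (ln B - ln A).
have T0 : 0 < T.
  case/andP: eta01 => _ eta1.
  by rewrite mulr_gt0 ?subr_gt0// ltr_ln ?posrE// (lt_trans A0).
have g0 : 0 < G B by exact: lt_le_trans Gge.
pose w s := (G B)^-1 * W s.
pose Phi s := 1 + - (G B)^-1 * G s.
have cW : continuous W by case: (sW 0).
have cw : continuous w by move=> s; apply: cvgM; [exact: cvg_cst|exact: cW].
have dPhi (s : R) : is_derive s 1 Phi (- w s).
  have dGs := dG s.
  have dZ := is_deriveZ (- (G B)^-1) dGs.
  have dD := is_deriveD (is_derive_cst (1 : R) s 1) dZ.
  by rewrite /w -mulNr -[X in is_derive _ _ _ X]add0r; exact: dD.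
have sPhi k : smooth1 k Phi.
  apply: smooth1_antiderivative dPhi _ k => k.
  rewrite (_ : (fun s => - w s) = (fun s => - (G B)^-1 * W s)).
    exact: smooth1_scale.
  by apply/funext => s; rewrite /w mulNr.
have w0 s : ~~ (A < s < B) -> w s = 0 by move=> hs; rewrite /w W0// mulr0.
have PhiB s : B <= s -> Phi s = 0.
  by move=> hs; rewrite /Phi (GB _ hs) mulNr mulVf ?gt_eqF// subrr.
exists Phi, w; split.
- move=> Om d BOm; have supp : closure [set z | (Phi \o sqd d) z != 0] `<=` [set z | sqd d z <= B].
    move=> z /(closure_subset _) h.
    rewrite [X in X z](iffLR (closure_id _) (@closed_sqd_le R d B)).
    apply: h => y /= hy; rewrite leNgt; apply/negP => By.
    by move: hy; rewrite PhiB ?ltW// eqxx.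
  split.
  + by move=> k; exact: Ck_comp_sqd.
  + apply: (@subclosed_compact _ _ [set z | sqd d z <= B]) => //.
      exact: closed_closure.
    exact: compact_sqd_le.
  + exact: subset_trans supp BOm.
- split=> s hs; last exact: PhiB.
  by rewrite /Phi (GA _ hs) mulr0 addr0.
- move=> d z; split.
    by have [_ <-] := is_derive_comp_x (dPhi _) (is_derive_sqd_x d z).
  by have [_ <-] := is_derive_comp_y (dPhi _) (is_derive_sqd_y d z).
- split=> // s.
    by rewrite mulr_ge0 ?invr_ge0 ?(ltW g0)//; case: (Wpos s).
  rewrite /w -mulrA; apply: (@le_trans _ _ (G B)^-1).
    by rewrite ger_pMr ?invr_gt0//; case: (Wpos s).
  by rewrite lef_pV2 ?posrE.
- have B0 : 0 < B by exact: lt_trans AB.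
  rewrite (@integral_support _ _ _ _ (`[0%R, B]%classic : set (measurableTypeR R)) `[0%R, +oo[%classic)//.
  + rewrite (@FTC_is_derive _ w (fun s => (G B)^-1 * G s))//.
    * by rewrite (GA 0) ?(ltW A0)// mulr0 subr0 mulVf ?gt_eqF.
    * exact: continuous_subspaceT.
  + by move=> s; rewrite /= !in_itv/= andbT => /andP[].
  + move=> s; rewrite /= !in_itv/= andbT => s0 hs; congr EFin; apply: w0.
    rewrite negb_and -!leNgt; apply/orP; right; rewrite leNgt.
    by apply/negP => sB; apply: hs; rewrite s0 ltW.
Qed.

Lemma dx_near_cst (f : R * R -> R) z (c : R) :
  (\forall y \near z, f y = c) -> dx f z = 0.
Proof.
move=> fc; suff /is_derive_dxE[] : is_derive z.1 1 (fun t : R => f (t, z.2)) 0 by [].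
apply: (@near_eq_is_derive _ _ _ (cst c)).
have h := @continuous_pair_l R z.2 z.1.
rewrite /continuous_at -surjective_pairing in h.
have hc : \forall t \near z.1, f (t, z.2) = c := h _ fc.
by apply: filterS hc => t ->.
Qed.

Lemma dy_near_cst (f : R * R -> R) z (c : R) :
  (\forall y \near z, f y = c) -> dy f z = 0.
Proof.
move=> fc; suff /is_derive_dyE[] : is_derive z.2 1 (fun t : R => f (z.1, t)) 0 by [].
apply: (@near_eq_is_derive _ _ _ (cst c)).
have h := @continuous_pair_r R z.1 z.2.
rewrite /continuous_at -surjective_pairing in h.
have hc : \forall t \near z.2, f (z.1, t) = c := h _ fc.
by apply: filterS hc => t ->.
Qed.

Lemma near_sqd_lt d (A : R) z : sqd d z < A -> \forall y \near z, sqd d y < A.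
Proof.
move=> zA; exact: (@cvgr_lt _ _ (nbhs z) _ (sqd d) (sqd d z) (@continuous_sqd _ d z) A zA).
Qed.

(** A point z of the closed disk is the limit of the points d + t (z - d) with
    t < 1, which lie in the open disk. *)
Lemma continuous_zero_disk (h : R * R -> R) d (A : R) : 0 < A -> continuous h ->
  (forall z, sqd d z < A -> h z = 0) -> forall z, sqd d z <= A -> h z = 0.
Proof.
move=> A0 ch h0 z zA; apply: contrapT => /eqP hz.
pose g (t : R) : R * R := (d.1 + t * (z.1 - d.1), d.2 + t * (z.2 - d.2)).
have g1 : g 1 = z by rewrite [RHS]surjective_pairing /g; congr pair; ring.
have cg : g t @[t --> (1 : R)] --> g 1.
  apply: (cvg_pair (F := nbhs (1 : R)) (G := nbhs (g 1).1) (H := nbhs (g 1).2)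
    (f := fun t : R => d.1 + t * (z.1 - d.1)) (g := fun t : R => d.2 + t * (z.2 - d.2))).
    by apply: cvgD; [exact: cvg_cst|apply: cvgM; [exact: cvg_id|exact: cvg_cst]].
  by apply: cvgD; [exact: cvg_cst|apply: cvgM; [exact: cvg_id|exact: cvg_cst]].
have chg : h (g t) @[t --> (1 : R)^'-] --> h z.
  by apply: cvg_at_left_filter; rewrite -g1; exact: (cvg_comp _ _ cg (ch (g 1))).
have n1 : \forall t \near (1 : R)^'-, h (g t) != 0.
  exact: (cvgr_neq0 _ chg hz).
have n2 : \forall t \near (1 : R)^'-, 0 < t < 1.
  near=> t; apply/andP; split; near: t.
    exact: nbhs_left_gt.
  exact: nbhs_left_lt.
have [t [ht /andP[t0 t1]]] := @filter_ex _ _ (at_left_proper_filter (1 : R)) _ (filterI n1 n2).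
move/eqP: ht; apply; apply: h0; rewrite /sqd /g /=.
apply: (@lt_le_trans _ _ A); last by [].
have -> : (d.1 + t * (z.1 - d.1) - d.1) ^+ 2 + (d.2 + t * (z.2 - d.2) - d.2) ^+ 2 =
    t ^+ 2 * sqd d z.
  by rewrite /sqd; ring.
have t2 : t ^+ 2 < 1 by rewrite expr_lt1 ?ltW.
have := sqd_ge0 d z; rewrite le_eqVlt => /predU1P[<-|s0]; first by rewrite mulr0.
by apply: (lt_le_trans _ zA); rewrite gtr_pMl.
Unshelve. all: by end_near. Qed.

(** On the boundary circle this rests on the continuity of the gradient: the
    horizontal line through the top of a disk meets it in one point only, so there
    the partial derivative cannot be read off the values in the disk. *)
Lemma grad_cst_disk (phi : R * R -> R) d (A c : R) : 0 < A -> Ck 1 phi ->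
  (forall z, sqd d z <= A -> phi z = c) ->
  forall z, sqd d z <= A -> dx phi z = 0 /\ dy phi z = 0.
Proof.
move=> A0 k1 phic z zA; have [_ _ kx ky] := Ck_is_derive k1.
split.
  apply: (continuous_zero_disk A0 (Ck_continuous kx) _ zA) => y yA.
  apply: (@dx_near_cst _ _ c); have := near_sqd_lt yA.
  by apply: filterS => x /ltW; exact: phic.
apply: (continuous_zero_disk A0 (Ck_continuous ky) _ zA) => y yA.
apply: (@dy_near_cst _ _ c); have := near_sqd_lt yA.
by apply: filterS => x /ltW; exact: phic.
Qed.

(** Off the disk where zeta vanishes the field (z - d) / |z - d|^2 is smooth and
    divergence free, hence its pairing with the gradient of zeta is the divergence of
    the compactly supported field zeta (z - d) / |z - d|^2. *)
Lemma flux_vanishing (zeta : R * R -> R) d (A M : R) : 0 < A -> 0 <= M -> Ck 1 zeta ->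
  (forall z, sqd d z <= A -> zeta z = 0) ->
  (forall z, M < `|z.1| \/ M < `|z.2| -> zeta z = 0) ->
  let E z := ((z.1 - d.1) * dx zeta z + (z.2 - d.2) * dy zeta z) / sqd d z in
  leb2.-integrable [set: plane R] (EFin \o E) /\ (\int[leb2]_z (E z)%:E = 0)%E.
Proof.
move=> A0 M0 k1 zA zM E; have [dzx dzy kx ky] := Ck_is_derive k1.
have grad0 := grad_cst_disk A0 k1 zA.
have cz := Ck_continuous k1; have cx := Ck_continuous kx; have cy := Ck_continuous ky.
pose P1 z := (z.1 - d.1) * (sqd d z)^-1 * zeta z.
pose P2 z := (z.2 - d.2) * (sqd d z)^-1 * zeta z.
pose g1 z := (z.1 - d.1) * (sqd d z)^-1 * dx zeta z +
  ((sqd d z)^-1 - 2 * (z.1 - d.1) ^+ 2 * (sqd d z)^-1 ^+ 2) * zeta z.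
pose g2 z := (z.2 - d.2) * (sqd d z)^-1 * dy zeta z +
  ((sqd d z)^-1 - 2 * (z.2 - d.2) ^+ 2 * (sqd d z)^-1 ^+ 2) * zeta z.
have cinv z : A <= sqd d z -> (sqd d y)^-1 @[y --> z] --> (sqd d z)^-1.
  move=> Az; apply: cvgV; last exact: continuous_sqd.
  by rewrite gt_eqF// (lt_le_trans A0).
have cfst (z : R * R) : (y.1 - d.1) @[y --> z] --> z.1 - d.1.
  by apply: cvgB; [exact: cvg_fst|exact: cvg_cst].
have csnd (z : R * R) : (y.2 - d.2) @[y --> z] --> z.2 - d.2.
  by apply: cvgB; [exact: cvg_snd|exact: cvg_cst].
have c1 : continuous g1.
  move=> z; have [zlt|zge] := ltP (sqd d z) A.
    have g0 y : sqd d y < A -> g1 y = 0.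
      by move=> yA; rewrite /g1 (grad0 _ (ltW yA)).1 (zA _ (ltW yA)) !mulr0 addr0.
    rewrite /continuous_at g0//; apply: cvg_near_cst.
    by apply: filterS (near_sqd_lt zlt) => y /g0 ->.
  apply: cvgD; apply: cvgM.
  - by apply: cvgM; [exact: cfst|exact: cinv].
  - exact: cx.
  - apply: cvgB; first exact: cinv.
    apply: cvgM; last by apply: cvgM; exact: cinv.
    by apply: cvgM; [exact: cvg_cst|apply: cvgM; exact: cfst].
  - exact: cz.
have c2 : continuous g2.
  move=> z; have [zlt|zge] := ltP (sqd d z) A.
    have g0 y : sqd d y < A -> g2 y = 0.
      by move=> yA; rewrite /g2 (grad0 _ (ltW yA)).2 (zA _ (ltW yA)) !mulr0 addr0.
    rewrite /continuous_at g0//; apply: cvg_near_cst.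
    by apply: filterS (near_sqd_lt zlt) => y /g0 ->.
  apply: cvgD; apply: cvgM.
  - by apply: cvgM; [exact: csnd|exact: cinv].
  - exact: cy.
  - apply: cvgB; first exact: cinv.
    apply: cvgM; last by apply: cvgM; exact: cinv.
    by apply: cvgM; [exact: cvg_cst|apply: cvgM; exact: csnd].
  - exact: cz.
have d1 z : is_derive z (1, 0) P1 (g1 z).
  have [zlt|zge] := ltP (sqd d z) A.
    have -> : g1 z = 0 by rewrite /g1 (grad0 _ (ltW zlt)).1 (zA _ (ltW zlt)) !mulr0 addr0.
    apply: (@near_eq_is_derive _ _ _ (cst 0)).
    by apply: filterS (near_sqd_lt zlt) => y /ltW yA; rewrite /P1 zA// mulr0.
  have s0 : sqd d z != 0 by rewrite gt_eqF// (lt_le_trans A0).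
  apply/is_derive_dxE.
  have /is_derive_dxE hs := is_derive_sqd_x d z.
  have /is_derive_dxE hz := dzx z.
  have hV := @is_deriveV _ (fun t => sqd d (t, z.2)) z.1 _ 1 s0 hs.
  have hB : is_derive z.1 1 (fun t : R => t - d.1) 1.
    by apply: is_derive_eq; rewrite subr0.
  apply: is_derive_eq (is_derive_mul (is_derive_mul hB hV) hz) _.
  rewrite /g1 -!surjective_pairing /GRing.scale/=.
  by move: s0 => + ; move: (sqd d z) => s s0; field.
have d2 z : is_derive z (0, 1) P2 (g2 z).
  have [zlt|zge] := ltP (sqd d z) A.
    have -> : g2 z = 0 by rewrite /g2 (grad0 _ (ltW zlt)).2 (zA _ (ltW zlt)) !mulr0 addr0.
    apply: (@near_eq_is_derive _ _ _ (cst 0)).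
    by apply: filterS (near_sqd_lt zlt) => y /ltW yA; rewrite /P2 zA// mulr0.
  have s0 : sqd d z != 0 by rewrite gt_eqF// (lt_le_trans A0).
  apply/is_derive_dyE.
  have /is_derive_dyE hs := is_derive_sqd_y d z.
  have /is_derive_dyE hz := dzy z.
  have hV := @is_deriveV _ (fun t => sqd d (z.1, t)) z.2 _ 1 s0 hs.
  have hB : is_derive z.2 1 (fun t : R => t - d.2) 1.
    by apply: is_derive_eq; rewrite subr0.
  apply: is_derive_eq (is_derive_mul (is_derive_mul hB hV) hz) _.
  rewrite /g2 -!surjective_pairing /GRing.scale/=.
  by move: s0 => + ; move: (sqd d z) => s s0; field.
have [i1 I1] : leb2.-integrable [set: plane R] (EFin \o g1) /\ (\int[leb2]_z (g1 z)%:E = 0)%E.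
  by apply: (integral_dx_compact M0 c1 d1) => z /zM; rewrite /P1 => ->; rewrite mulr0.
have [i2 I2] : leb2.-integrable [set: plane R] (EFin \o g2) /\ (\int[leb2]_z (g2 z)%:E = 0)%E.
  by apply: (integral_dy_compact M0 c2 d2) => z /zM; rewrite /P2 => ->; rewrite mulr0.
have EE z : E z = g1 z + g2 z.
  have [zA'|zA'] := leP (sqd d z) A.
    by rewrite /E /g1 /g2 (grad0 _ zA').1 (grad0 _ zA').2 (zA _ zA') !mulr0 !addr0 mul0r.
  have s0 : sqd d z != 0 by rewrite gt_eqF// (lt_trans A0).
  rewrite /E /g1 /g2; move: s0 (erefl (sqd d z)); rewrite {2}/sqd.
  move: (sqd d z) (dx zeta z) (dy zeta z) (zeta z) => s a b c s0 hs.
  have -> : (z.1 - d.1) ^+ 2 = s - (z.2 - d.2) ^+ 2 by rewrite -hs addrK.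
  by field.
rewrite (_ : EFin \o E = ((EFin \o g1) \+ (EFin \o g2))%E); last first.
  by apply/funext => z /=; rewrite EE.
split; first exact: integrableD.
under eq_integral do rewrite EE EFinD.
by rewrite integralD//= I1 I2 adde0.
Qed.

Lemma integral_radial_weight d (w : R -> R) : continuous w -> (forall s, 0 <= w s) ->
  (\int[@lebesgue_measure R]_(s in `[0%R, +oo[) (w s)%:E = 1)%E ->
  leb2.-integrable [set: plane R] (fun z => (w (sqd d z))%:E) /\
  (\int[leb2]_z (w (sqd d z))%:E = pi%:E)%E.
Proof.
move=> cw w0 Iw.
have I : (\int[leb2]_z (w (sqd d z))%:E = pi%:E)%E.
  rewrite (@integral_radial _ d (fun s => (w s)%:E)) ?Iw ?mule1//.
  by apply/measurable_EFinP; exact: continuous_measurable_fun.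
split=> //; apply/integrableP; split.
  apply/measurable_EFinP; apply: continuous_measurable_plane => z.
  by apply: continuous_comp; [exact: continuous_sqd|exact: cw].
under eq_integral do rewrite /= ger0_norm//.
by rewrite I ltry.
Qed.

(** Subtracting c times a radial cutoff chi reduces to flux_vanishing. For chi the
    integrand is - 2 w (|z - d|^2) with a weight w of mass 1 in the variable |z - d|^2,
    and the area of the ring is pi ds. *)
Lemma flux_cst_disk (phi : R * R -> R) d (A M c : R) : 0 < A -> 0 <= M ->
  (forall k, Ck k phi) ->
  (forall z, sqd d z <= A -> phi z = c) ->
  (forall z, M < `|z.1| \/ M < `|z.2| -> phi z = 0) ->
  let E z := ((z.1 - d.1) * dx phi z + (z.2 - d.2) * dy phi z) / sqd d z in
  leb2.-integrable [set: plane R] (EFin \o E) /\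
  (\int[leb2]_z (E z)%:E = (- (2 * pi * c))%:E)%E.
Proof.
move=> A0 M0 kphi pA pM E.
have [||Phi [w [tPhi [Phi1 Phi0] dPhi [cw w0 _ ws] Iw]]] :=
  @radial_cutoff A (2 * A) 2^-1 A0; [lra|lra|].
have [kchi _ _] := tPhi setT d (@subsetT _ _).
pose chi : R * R -> R := Phi \o sqd d.
have chi1 z : sqd d z <= A -> chi z = 1 by exact: Phi1.
have chi0 z : 2 * A <= sqd d z -> chi z = 0 by exact: Phi0.
have dchi := dPhi d.
pose M1 := M + `|d.1| + `|d.2| + 2 * A + 1.
have n1 := normr_ge0 d.1; have n2 := normr_ge0 d.2.
have M10 : 0 <= M1 by rewrite /M1; lra.
have MM1 : M <= M1 by rewrite /M1; lra.
have chiM z : M1 < `|z.1| \/ M1 < `|z.2| -> chi z = 0.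
  move=> hz; apply: chi0; rewrite /sqd.
  have sq (u v : R) : M1 < `|u| -> (v = d.1 \/ v = d.2) -> 2 * A <= (u - v) ^+ 2.
    move=> hu hv; have h : 2 * A + 1 <= `|u - v|.
      have := ler_normB (u - v) (- v); rewrite opprK subrK normrN.
      by case: hv => ->; move: hu; rewrite /M1; lra.
    rewrite -real_normK ?num_real//; nra.
  have q1 := sqr_ge0 (z.1 - d.1); have q2 := sqr_ge0 (z.2 - d.2).
  by case: hz => /sq h; [have := h d.1 (or_introl erefl)|have := h d.2 (or_intror erefl)]; lra.
pose zeta z := phi z + - c * chi z.
have kzeta : Ck 1 zeta by apply: Ck_add => //; apply: Ck_mul => //; exact: Ck_cst.
have [] := @flux_vanishing zeta d A M1 A0 M10 kzeta.
- by move=> z hz; rewrite /zeta pA// chi1// mulr1 subrr.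
- move=> z hz; rewrite /zeta chiM// mulr0 addr0 pM//.
  by case: hz => hz; [left|right]; exact: le_lt_trans hz.
move=> iz Iz.
have [iw Iw'] := integral_radial_weight d cw w0 Iw.
have [px py _ _] := Ck_is_derive (kphi 1).
have [cx cy _ _] := Ck_is_derive (kchi 1).
have [zx zy _ _] := Ck_is_derive kzeta.
pose Z z := ((z.1 - d.1) * dx zeta z + (z.2 - d.2) * dy zeta z) / sqd d z.
have EE z : E z = Z z + - (2 * c) * w (sqd d z).
  have -> : Z z = E z + - c * (((z.1 - d.1) * dx chi z + (z.2 - d.2) * dy chi z) / sqd d z).
    rewrite /Z.
    have -> : dx zeta z = dx phi z + - c * dx chi z.
      have [_ <-] := is_deriveD (px z) (is_deriveZ (- c) (cx z)); exact: erefl.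
    have -> : dy zeta z = dy phi z + - c * dy chi z.
      have [_ <-] := is_deriveD (py z) (is_deriveZ (- c) (cy z)); exact: erefl.
    by rewrite /E; ring.
  rewrite (dchi z).1 (dchi z).2.
  have [s0|s0] := eqVneq (sqd d z) 0.
    by rewrite ws ?s0 ?invr0 ?mulr0 ?addr0// negb_and -leNgt (ltW A0).
  rewrite -[E z in LHS]addr0 -addrA; congr (_ + _).
  move: (erefl (sqd d z)); rewrite {2}/sqd => hs.
  have -> : (z.1 - d.1) * (- w (sqd d z) * (2 * (z.1 - d.1))) +
      (z.2 - d.2) * (- w (sqd d z) * (2 * (z.2 - d.2))) =
    - (2 * w (sqd d z)) * sqd d z by rewrite [in X in _ = _ * X]hs; ring.
  by field.
have i2 : leb2.-integrable [set: plane R] (fun z => ((- (2 * c))%:E * (w (sqd d z))%:E)%E).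
  exact: integrableZl.
rewrite (_ : EFin \o E = (EFin \o Z) \+ (fun z => (- (2 * c))%:E * (w (sqd d z))%:E))%E; last first.
  by apply/funext => z /=; rewrite EE.
split; first exact: integrableD.
under eq_integral do rewrite EE EFinD EFinM.
have I2 : (\int[leb2]_z ((- (2 * c))%:E * (w (sqd d z))%:E) = (- (2 * c) * pi)%:E)%E.
  by rewrite integralZl// Iw' EFinM.
rewrite integralD// [X in (X + _)%E]Iz [X in (_ + X)%E]I2 add0e; congr EFin; ring.
Qed.

End Cutoff.

(** * The energy density *)

Section QuadraticForm.
Context {R : realType}.
Implicit Types (p q : R * R) (C K Rc : R).

Definition energy_density C K Rc p q : R :=
  2^-1 * (C * dot p p + K * dot q q + 2 * Rc * dot p q).

Lemma enorm_sqr p : enorm p ^+ 2 = dot p p.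
Proof. by rewrite sqr_sqrtr// /dot -!expr2 addr_ge0 ?sqr_ge0. Qed.

Lemma energyE C K Rc D f g :
  energy C K Rc D f g = (\int[leb2]_(z in D) (energy_density C K Rc (f z) (g z))%:E)%E.
Proof. by apply: eq_integral => z _; rewrite !enorm_sqr. Qed.

Lemma quadratic_ge0 C K Rc (x y : R) : 0 < C -> Rc ^+ 2 < C * K ->
  0 <= C * x ^+ 2 + K * y ^+ 2 + 2 * Rc * x * y.
Proof.
move=> C0 CKR; rewrite -(pmulr_rge0 _ C0).
have -> : C * (C * x ^+ 2 + K * y ^+ 2 + 2 * Rc * x * y) =
  (C * x + Rc * y) ^+ 2 + (C * K - Rc ^+ 2) * y ^+ 2 by ring.
by rewrite addr_ge0 ?sqr_ge0// mulr_ge0 ?sqr_ge0// subr_ge0 ltW.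
Qed.

Lemma energy_density_ge0 C K Rc p q : 0 < C -> Rc ^+ 2 < C * K -> 0 <= energy_density C K Rc p q.
Proof.
move=> C0 CKR; have := quadratic_ge0 p.1 q.1 C0 CKR.
by have := quadratic_ge0 p.2 q.2 C0 CKR; rewrite /energy_density /dot; lra.
Qed.

(** The form is nonnegative at (p - p0, q - q0): a convex quadratic function lies
    above its tangent at (p0, q0). *)
Lemma energy_density_polar C K Rc p q p0 q0 : 0 < C -> Rc ^+ 2 < C * K ->
  C * dot p p0 + K * dot q q0 + Rc * (dot p q0 + dot q p0)
    - energy_density C K Rc p0 q0 <= energy_density C K Rc p q.
Proof.
move=> C0 CKR; have := energy_density_ge0 (p - p0) (q - q0) C0 CKR.
rewrite -subr_ge0 => h; rewrite -subr_ge0.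
apply: (le_trans h); rewrite le_eqVlt; apply/orP; left; apply/eqP.
by rewrite /energy_density /dot /=; field.
Qed.

End QuadraticForm.

Section L2Tools.
Context {R : realType}.
Implicit Types (D : set (plane R)).

Lemma L2_mul D (f g : R * R -> R) : measurable D -> L2 D f -> L2 D g ->
  leb2.-integrable D (fun z => (f z * g z)%:E).
Proof.
move=> mD [mf if2] [mg ig2].
apply: (le_integrable mD _ _ (integrableD mD if2 ig2)).
  by apply/measurable_EFinP; exact: (@measurable_funM _ (plane R) R D f g mf mg).
move=> z Dz /=; rewrite lee_fin.
rewrite [leRHS]ger0_norm ?addr_ge0 ?sqr_ge0// normrM.
rewrite -[f z ^+ 2]real_normK ?num_real// -[g z ^+ 2]real_normK ?num_real//.
have := sqr_ge0 (`|f z| - `|g z|); have := normr_ge0 (f z); have := normr_ge0 (g z).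
move: `|f z| `|g z| => a b; nra.
Qed.

Lemma L2_bounded D (f : R * R -> R) (c : R) : measurable D -> (leb2 D < +oo)%E ->
  @measurable_fun _ _ (plane R) R D f -> (forall z, D z -> `|f z| <= c) -> L2 D f.
Proof.
move=> mD Doo mf fc; split; first exact: mf.
apply: (integrable_le_cst (c := c ^+ 2)) => //.
  by apply: measurable_funX.
move=> z Dz; rewrite normrX lerXn2r ?nnegrE// ?fc//.
exact: le_trans (normr_ge0 _) (fc z Dz).
Qed.

Lemma integrable_edens D C K Rc f g : measurable D -> L2v D f -> L2v D g ->
  leb2.-integrable D (fun z => (energy_density C K Rc (f z) (g z))%:E).
Proof.
move=> mD [f1 f2] [g1 g2].
have m11 := L2_mul mD f1 f1; have m22 := L2_mul mD f2 f2.
have n11 := L2_mul mD g1 g1; have n22 := L2_mul mD g2 g2.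
have k11 := L2_mul mD f1 g1; have k22 := L2_mul mD f2 g2.
have h := integrableD mD (integrableD mD
  (integrableZl mD (2^-1 * C) (integrableD mD m11 m22))
  (integrableZl mD (2^-1 * K) (integrableD mD n11 n22)))
  (integrableZl mD Rc (integrableD mD k11 k22)).
apply: eq_integrable h => // z _ /=.
rewrite -?EFinD -?EFinM -?EFinD.
by congr EFin; rewrite /energy_density /dot; field.
Qed.

End L2Tools.

Section Perforated.
Context {R : realType}.
Variables (Om : set (R * R)) (N : nat) (d : 'I_N -> R * R).
Hypotheses (Om_open : open Om) (Om_bounded : bounded_set Om).

Lemma measurable_Om : measurable (Om : set (plane R)).
Proof. exact: open_measurable_plane. Qed.

Lemma leb2_Om_lty : (leb2 Om < +oo)%E.
Proof. exact: bounded_leb2_lty measurable_Om Om_bounded. Qed.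

Lemma measurable_perforated eps : 0 <= eps ->
  measurable (perforated Om d eps : set (plane R)).
Proof.
move=> e0; apply: measurableD; first exact: measurable_Om.
apply: fin_bigcup_measurable => // i _.
by rewrite disk_sqd//; exact: measurable_sqd_le.
Qed.

Lemma perforated_sub eps : perforated Om d eps `<=` Om.
Proof. by move=> z []. Qed.

Lemma leb2_perforated_lty eps : 0 <= eps -> (leb2 (perforated Om d eps) < +oo)%E.
Proof.
move=> e0; apply: le_lt_trans leb2_Om_lty.
apply: le_measure; rewrite ?inE; [exact: measurable_perforated|exact: measurable_Om|].
exact: perforated_sub.
Qed.

Lemma perforated_sqd eps z i : 0 <= eps -> perforated Om d eps z ->
  eps ^+ 2 < sqd (d i) z.
Proof.
move=> e0 [_ hz]; rewrite ltNge; apply/negP => h; apply: hz.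
by exists i => //; rewrite disk_sqd.
Qed.

End Perforated.

(** * The lower bound *)

Section LowerBound.
Context {R : realType}.
Variables (Om : set (R * R)) (N : nat) (d : 'I_N -> R * R) (bu bw : 'I_N -> R).
Variables (C K Rc eps0 : R).
Hypotheses (Om_open : open Om) (Om_bounded : bounded_set Om).
Hypotheses (C_gt0 : 0 < C) (CKR : Rc ^+ 2 < C * K) (eps0_gt0 : 0 < eps0).
Hypotheses (disks_disj : forall i j, i != j ->
       disk (d i) eps0 `&` disk (d j) eps0 = set0)
  (disks_Om : forall i, disk (d i) eps0 `<=` Om).

Lemma disk_far i j z : i != j -> sqd (d i) z <= eps0 ^+ 2 -> eps0 ^+ 2 < sqd (d j) z.
Proof.
move=> ij iz; rewrite ltNge; apply/negP => jz.
have : (disk (d i) eps0 `&` disk (d j) eps0) z by rewrite !disk_sqd ?ltW.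
by rewrite disks_disj.
Qed.

(** The component of the vector v along the rotated position vector z - c,
    multiplied by the distance from z to c. *)
Definition azimuthal (v c z : R * R) : R := v.2 * (z.1 - c.1) - v.1 * (z.2 - c.2).

Let coef i := C * bu i ^+ 2 + K * bw i ^+ 2 + 2 * Rc * bu i * bw i.

Lemma core_energyE : core_energy C K Rc bu bw = \sum_i coef i / (4 * pi).
Proof. by []. Qed.

Lemma coef_ge0 i : 0 <= coef i.
Proof. exact: quadratic_ge0. Qed.

(** The tangent inequality at the trial fields lam w a and lam w b times the
    rotated position vector z - c; these are vortices, rescaled by lam w |z - c|^2. *)
Lemma energy_density_azimuthal (f g z c : R * R) (a b w k lam : R) : 0 <= w ->
  w * sqd c z <= k ->
  lam * w * ((C * a + Rc * b) * azimuthal f c z + (K * b + Rc * a) * azimuthal g c z)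
   - 2^-1 * lam ^+ 2 * k * (C * a ^+ 2 + K * b ^+ 2 + 2 * Rc * a * b) * w
  <= energy_density C K Rc f g.
Proof.
move=> w0 wk.
pose p0 : R * R := (- (lam * w * a * (z.2 - c.2)), lam * w * a * (z.1 - c.1)).
pose q0 : R * R := (- (lam * w * b * (z.2 - c.2)), lam * w * b * (z.1 - c.1)).
apply: le_trans (energy_density_polar f g p0 q0 C_gt0 CKR).
have q_ge0 := quadratic_ge0 a b C_gt0 CKR.
set Q := C * a ^+ 2 + _ + _ in q_ge0 *.
have -> : C * dot f p0 + K * dot g q0 + Rc * (dot f q0 + dot g p0) =
  lam * w * ((C * a + Rc * b) * azimuthal f c z + (K * b + Rc * a) * azimuthal g c z).
  by rewrite /dot /azimuthal /p0 /q0 /=; ring.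
have -> : energy_density C K Rc p0 q0 = 2^-1 * lam ^+ 2 * (w * sqd c z) * Q * w.
  by rewrite /energy_density /dot /sqd /p0 /q0 /Q /=; field.
rewrite lerD2l lerN2; apply: ler_wpM2r => //; apply: ler_wpM2r => //.
by apply: ler_wpM2l => //; rewrite mulr_ge0 ?sqr_ge0.
Qed.

(** The gradient of the test function Phi (|z - d i|^2) is radial, so that the
    circulation only sees the azimuthal component of f. *)
Lemma circulation_weight (eps : R) f i (b : R) (Phi w : R -> R) : 0 < eps -> eps < eps0 ->
  test_function Om (Phi \o sqd (d i)) ->
  (forall s, s <= eps ^+ 2 -> Phi s = 1) -> (forall s, eps0 ^+ 2 <= s -> Phi s = 0) ->
  (forall z, dx (Phi \o sqd (d i)) z = - w (sqd (d i) z) * (2 * (z.1 - (d i).1)) /\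
             dy (Phi \o sqd (d i)) z = - w (sqd (d i) z) * (2 * (z.2 - (d i).2))) ->
  circulation Om d eps f i b ->
  \int[leb2]_(z in perforated Om d eps)
    (2 * (w (sqd (d i) z) * azimuthal (f z) (d i) z)) = b.
Proof.
move=> e0 ee0 tPhi Phi1 Phi0 dPhi /(_ _ tPhi) <-.
  apply: eq_Rintegral => z _; rewrite (dPhi z).1 (dPhi z).2 /azimuthal.
  by ring.
move=> j z; rewrite disk_sqd ?ltW//= => jz.
have [ij|ij] := eqVneq i j; first by rewrite Phi1// ij.
rewrite Phi0//; apply: ltW; apply: (@disk_far j); first by rewrite eq_sym.
by apply: le_trans jz _; rewrite lerXn2r ?nnegrE ?ltW.
Qed.

(** Integrating energy_density_azimuthal bounds the energy below by the sum of
    coef i (lam / 2 - lam^2 k pi / 2). The choice lam = 1 / (2 pi k) maximizes this,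
    and the value is coef i / (8 pi k) with k = 1 / (2 (1 - eta) ln (eps0 / eps)). *)
Lemma energy_lower (eps : R) f g (eta : R) : 0 < eps -> eps < eps0 -> 0 < eta < 1 ->
  H0eps Om d bu bw eps f g ->
  (((1 - eta) * (ln eps0 - ln eps) * core_energy C K Rc bu bw)%:E
    <= energy C K Rc (perforated Om d eps) f g)%E.
Proof.
move=> e0 ee0 eta01 [[Lf Lg] _ circf circg].
set Ome := perforated Om d eps.
have mOme : measurable (Ome : set (plane R)) by apply: measurable_perforated => //; exact: ltW.
have Omeoo : (leb2 Ome < +oo)%E by apply: leb2_perforated_lty => //; exact: ltW.
have A0 : 0 < eps ^+ 2 by rewrite exprn_gt0.
have AB : eps ^+ 2 < eps0 ^+ 2 by rewrite ltrXn2r// ?nnegrE ltW.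
have [Phi [w [tPhi [Phi1 Phi0] dPhi [cw w0 wk ws] Iw]]] := radial_cutoff A0 AB eta01.
set k := (_)^-1 in wk.
have L0 : 0 < ln eps0 - ln eps by rewrite subr_gt0 ltr_ln.
have kE : k = ((1 - eta) * (2 * (ln eps0 - ln eps)))^-1.
  have lnsq (x : R) : 0 < x -> ln (x ^+ 2) = 2 * ln x by move=> x0; rewrite lnXn// mulr_natl.
  by rewrite /k (lnsq _ e0) (lnsq _ eps0_gt0) -mulrBr.
have eta1 : 0 < 1 - eta by case/andP: eta01; rewrite subr_gt0.
have k0 : 0 < k by rewrite kE invr_gt0 !mulr_gt0.
have pi0 := @pi_gt0 R.
pose lam := (2 * pi * k)^-1.
have tOm i : test_function Om (Phi \o sqd (d i)).
  by apply: tPhi; rewrite -disk_sqd ?ltW//.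
pose wi i z := w (sqd (d i) z).
have cwi i : continuous (wi i).
  by move=> z; apply: continuous_comp; [exact: continuous_sqd|exact: cw].
(* w s vanishes for s <= eps ^+ 2 and is at most k / s elsewhere *)
have wbound s u : u ^+ 2 <= s -> `|w s * u| <= k / eps.
  move=> us; have [hs|hs] := leP s (eps ^+ 2).
    by rewrite ws ?mul0r ?normr0 ?divr_ge0 ?(ltW k0) ?(ltW e0)// negb_and -leNgt hs.
  have s0 : 0 < s by exact: lt_trans hs.
  rewrite -ler_sqr ?nnegrE ?normr_ge0 ?divr_ge0 ?(ltW k0) ?(ltW e0)//.
  rewrite real_normK ?num_real// exprMn.
  have h1 : w s ^+ 2 * u ^+ 2 <= (w s * s) * w s.
    have -> : (w s * s) * w s = w s ^+ 2 * s by ring.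
    by rewrite ler_wpM2l ?sqr_ge0.
  apply: (le_trans h1); rewrite expr_div_n ler_pdivlMr//.
  have h2 : w s * eps ^+ 2 <= k.
    by apply: le_trans (wk s); rewrite ler_wpM2l// ltW.
  have -> : w s * s * w s * eps ^+ 2 = (w s * s) * (w s * eps ^+ 2) by ring.
  rewrite [k ^+ 2]expr2; apply: ler_pM => //.
    by rewrite mulr_ge0// ltW.
  by rewrite mulr_ge0// ltW.
have Lw1 i : L2 Ome (fun z => wi i z * (z.1 - (d i).1)).
  apply: (@L2_bounded _ _ _ (k / eps)) => //.
    apply: measurable_funTS; apply: continuous_measurable_plane => z.
    by apply: cvgM; [exact: cwi|apply: cvgB; [exact: cvg_fst|exact: cvg_cst]].
  by move=> z _; apply: wbound; rewrite /sqd lerDl sqr_ge0.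
have Lw2 i : L2 Ome (fun z => wi i z * (z.2 - (d i).2)).
  apply: (@L2_bounded _ _ _ (k / eps)) => //.
    apply: measurable_funTS; apply: continuous_measurable_plane => z.
    by apply: cvgM; [exact: cwi|apply: cvgB; [exact: cvg_snd|exact: cvg_cst]].
  by move=> z _; apply: wbound; rewrite /sqd lerDr sqr_ge0.
have intw i : leb2.-integrable Ome (fun z => (wi i z)%:E) /\
    (\int[leb2]_(z in Ome) (wi i z)%:E <= pi%:E)%E.
  have [iw <-] := integral_radial_weight (d i) cw w0 Iw.
  split; first by apply: integrableS iw.
  apply: ge0_subset_integral => //; first by case/integrableP: iw.
  by move=> z _; rewrite lee_fin; exact: w0.
have inta h i : L2v Ome h ->
    leb2.-integrable Ome (fun z => (wi i z * azimuthal (h z) (d i) z)%:E).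
  move=> [h1 h2]; have := integrableB mOme (L2_mul mOme (Lw1 i) h2) (L2_mul mOme (Lw2 i) h1).
  apply: eq_integrable => // z _ /=; rewrite -?EFinB; congr EFin.
  by rewrite /azimuthal; ring.
have intc h i b : L2v Ome h -> circulation Om d eps h i b ->
    (\int[leb2]_(z in Ome) (wi i z * azimuthal (h z) (d i) z)%:E = (b / 2)%:E)%E.
  move=> Lh ch; have ia := inta h i Lh.
  have := @circulation_weight eps h i b Phi w e0 ee0 (tOm i) Phi1 Phi0 (dPhi (d i)) ch.
  rewrite RintegralZl// => E; rewrite -(fineK (integrable_fin_num _ ia))//.
  by congr EFin; rewrite -E /Rintegral; field.
(* the i-th term of a lower bound for the density; at each point at most one of
   these terms is nonzero *)
pose al i := C * bu i + Rc * bw i.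
pose be i := K * bw i + Rc * bu i.
pose hi i z := lam * wi i z * (al i * azimuthal (f z) (d i) z + be i * azimuthal (g z) (d i) z)
   - 2^-1 * lam ^+ 2 * k * coef i * wi i z.
have hi_le z : \sum_i hi i z <= energy_density C K Rc (f z) (g z).
  have hi0 j : wi j z = 0 -> hi j z = 0 by rewrite /hi => ->; rewrite !mulr0 mul0r subrr.
  have [[i wiz]|h0] := pselect (exists i, wi i z != 0); last first.
    rewrite big1 => [|j _]; first exact: energy_density_ge0.
    by apply: hi0; apply: contrapT => /eqP wj; apply: h0; exists j.
  rewrite (bigD1 i)//= big1 ?addr0 => [|j ji]; last first.
    apply: hi0; apply: (ws _ _); rewrite negb_and -!leNgt; apply/orP; right; apply: ltW.
    apply: (@disk_far i); first by rewrite eq_sym.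
    apply: contraNT wiz; rewrite -ltNge => hz; apply/eqP; apply: (ws _ _).
    by rewrite negb_and -!leNgt (ltW hz) orbT.
  by apply: energy_density_azimuthal; [exact: w0|exact: wk].
have ihi i : leb2.-integrable Ome (fun z => (hi i z)%:E) /\
   ((coef i / (8 * pi * k))%:E <= \int[leb2]_(z in Ome) (hi i z)%:E)%E.
  have if_ := inta f i Lf; have ig_ := inta g i Lg; have [iw iwle] := intw i.
  have i1 := integrableZl mOme (lam * al i) if_.
  have i2 := integrableZl mOme (lam * be i) ig_.
  have i3 := integrableZl mOme (- (2^-1 * lam ^+ 2 * k * coef i)) iw.
  have hE z : (hi i z)%:E = ((lam * al i)%:E * (wi i z * azimuthal (f z) (d i) z)%:E +
      ((lam * be i)%:E * (wi i z * azimuthal (g z) (d i) z)%:E +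
       (- (2^-1 * lam ^+ 2 * k * coef i))%:E * (wi i z)%:E))%E.
    by rewrite -!EFinM -!EFinD; congr EFin; rewrite /hi; ring.
  split.
    have := integrableD mOme i1 (integrableD mOme i2 i3).
    by apply: eq_integrable => // z _; rewrite hE.
  under eq_integral do rewrite hE.
  rewrite integralD//; last exact: integrableD.
  rewrite integralD// !integralZl// (intc f i (bu i))// (intc g i (bw i))//.
  have fw : (\int[leb2]_(z in Ome) (wi i z)%:E)%E \is a fin_num by exact: integrable_fin_num.
  move: iwle; rewrite -(fineK fw) lee_fin; set P := fine _ => Ple.
  rewrite -!EFinM -!EFinD lee_fin.
  have -> : coef i / (8 * pi * k) = lam * al i * (bu i / 2) + (lam * be i * (bw i / 2) +
      - (2^-1 * lam ^+ 2 * k * coef i) * pi).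
    rewrite /lam /al /be /coef; move: (@pi R) pi0 => p p0; field.
    by rewrite !lt0r_neq0.
  rewrite !lerD2l !mulNr lerN2; apply: ler_wpM2l => //.
  apply: mulr_ge0; last exact: coef_ge0.
  apply: mulr_ge0; last exact: ltW.
  by apply: mulr_ge0; [rewrite invr_ge0|exact: sqr_ge0].
have -> : (1 - eta) * (ln eps0 - ln eps) * core_energy C K Rc bu bw =
    \sum_i coef i / (8 * pi * k).
  rewrite core_energyE mulr_sumr; apply: eq_bigr => i _; rewrite kE.
  move: (@pi R) pi0 (ln eps0 - ln eps) L0 (1 - eta) eta1 => p p0 L L0' e e0'.
  by field; rewrite !lt0r_neq0.
rewrite energyE; apply: (@le_trans _ _ (\int[leb2]_(z in Ome) (\sum_i hi i z)%:E)%E).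
  under eq_integral do rewrite -sumEFin.
  rewrite integral_sum//; last by move=> i; case: (ihi i).
  by rewrite -sumEFin; apply: lee_sum => i _; case: (ihi i).
apply: le_integral => //.
- under eq_fun do rewrite -sumEFin.
  by apply: integrable_sum => // i _; case: (ihi i).
- exact: integrable_edens.
- by move=> z _; rewrite lee_fin.
Qed.

End LowerBound.

(** * The upper bound *)

Section EnergyDensityBounds.
Context {R : realType}.
Implicit Types (p q : R * R) (C K Rc : R).

(** The difference of both sides is eta^-1 times the form at
    (eta p - p', eta q - q'). *)
Lemma energy_density_split C K Rc p q p' q' (eta : R) : 0 < C -> Rc ^+ 2 < C * K -> 0 < eta ->
  energy_density C K Rc (p + p') (q + q') <=
  (1 + eta) * energy_density C K Rc p q + (1 + eta^-1) * energy_density C K Rc p' q'.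
Proof.
move=> C0 CKR eta0; rewrite -subr_ge0.
have -> : (1 + eta) * energy_density C K Rc p q + (1 + eta^-1) * energy_density C K Rc p' q' -
    energy_density C K Rc (p + p') (q + q') =
  eta^-1 * energy_density C K Rc (eta *: p - p') (eta *: q - q').
  rewrite /energy_density /dot /= /GRing.scale/=; field.
  by rewrite lt0r_neq0.
by rewrite mulr_ge0 ?energy_density_ge0// invr_ge0 ltW.
Qed.

Lemma energy_density_bounded C K Rc p q (m : R) : 0 < C -> 0 < K ->
  `|p.1| <= m -> `|p.2| <= m -> `|q.1| <= m -> `|q.2| <= m ->
  energy_density C K Rc p q <= (C + K + 2 * `|Rc|) * m ^+ 2.
Proof.
move=> C0 K0 p1 p2 q1 q2.
have m0 : 0 <= m by exact: le_trans p1.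
have prod (x y : R) : `|x| <= m -> `|y| <= m -> `|x * y| <= m ^+ 2.
  by move=> hx hy; rewrite normrM expr2; exact: ler_pM.
have sq (x : R) : `|x| <= m -> x * x <= m ^+ 2.
  by move=> hx; apply: le_trans (prod x x hx hx); exact: ler_norm.
have rc (x y : R) : `|x| <= m -> `|y| <= m -> Rc * (x * y) <= `|Rc| * m ^+ 2.
  move=> hx hy; apply: (le_trans (ler_norm _)); rewrite normrM.
  by apply: ler_wpM2l => //; exact: prod.
have a1 := ler_wpM2l (ltW C0) (sq _ p1); have a2 := ler_wpM2l (ltW C0) (sq _ p2).
have b1 := ler_wpM2l (ltW K0) (sq _ q1); have b2 := ler_wpM2l (ltW K0) (sq _ q2).
have c1 := rc _ _ p1 q1; have c2 := rc _ _ p2 q2.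
rewrite /energy_density /dot; move: a1 a2 b1 b2 c1 c2.
have : 0 <= `|Rc| * m ^+ 2 by rewrite mulr_ge0 ?sqr_ge0.
clear; lra.
Qed.

End EnergyDensityBounds.

Section Vortex.
Context {R : realType}.
Implicit Types (z c : R * R) (eps : R).

(** Freezing |z - c|^-2 inside the disk of radius eps makes the vortex bounded on
    the whole domain and changes nothing outside the disk. *)
Definition vortex_weight (eps : R) c z : R := (Num.max (sqd c z) (eps ^+ 2))^-1.

Definition vortex_field (eps : R) c z : R * R :=
  (- (vortex_weight eps c z * (z.2 - c.2)), vortex_weight eps c z * (z.1 - c.1)).

Lemma continuous_vortex_weight eps c : 0 < eps -> continuous (vortex_weight eps c).
Proof.
move=> e0 z; apply: cvgV.
  by rewrite gt_eqF// lt_max exprn_gt0// orbT.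
exact: (@continuous_max _ _ (sqd c) (cst (eps ^+ 2)) z (@continuous_sqd _ c z) (@cst_continuous _ _ _ z)).
Qed.

Lemma vortex_weight_gt0 eps c z : 0 < eps -> 0 < vortex_weight eps c z.
Proof. by move=> e0; rewrite invr_gt0 lt_max exprn_gt0// orbT. Qed.

Lemma vortex_weightE eps c z : eps ^+ 2 < sqd c z -> vortex_weight eps c z = (sqd c z)^-1.
Proof. by move=> h; rewrite /vortex_weight max_l// ltW. Qed.

Lemma vortex_weight_bound eps rho c z (u : R) : 0 < eps -> 0 < rho ->
  rho ^+ 2 <= Num.max (sqd c z) (eps ^+ 2) ->
  u ^+ 2 <= sqd c z -> `|vortex_weight eps c z * u| <= rho^-1.
Proof.
move=> e0 r0 rm us; rewrite /vortex_weight; set M := Num.max _ _ in rm *.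
have M0 : 0 < M by rewrite lt_max exprn_gt0// orbT.
have uM : u ^+ 2 <= M by rewrite (le_trans us)// le_max lexx.
rewrite -ler_sqr ?nnegrE ?invr_ge0 ?(ltW r0)// real_normK ?num_real//.
rewrite exprMn !exprVn; apply: (@le_trans _ _ M^-1).
  by rewrite mulrC ler_pdivrMr ?exprn_gt0// expr2 mulrA mulVf ?gt_eqF// mul1r.
by rewrite lef_pV2 ?posrE ?exprn_gt0.
Qed.

Lemma vortex_field_bound eps rho c z : 0 < eps -> 0 < rho ->
  rho ^+ 2 <= Num.max (sqd c z) (eps ^+ 2) ->
  `|(vortex_field eps c z).1| <= rho^-1 /\ `|(vortex_field eps c z).2| <= rho^-1.
Proof.
move=> e0 r0 h; split; rewrite /= ?normrN; apply: vortex_weight_bound => //.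
  by rewrite /sqd lerDr sqr_ge0.
by rewrite /sqd lerDl sqr_ge0.
Qed.

Lemma measurable_vortex_field eps c : 0 < eps ->
  measurable_fun [set: plane R] (fun z => (vortex_field eps c z).1) /\
  measurable_fun [set: plane R] (fun z => (vortex_field eps c z).2).
Proof.
move=> e0; have cw := @continuous_vortex_weight eps c e0.
split; apply: continuous_measurable_plane => z /=.
  by apply: cvgN; apply: cvgM; [exact: cw|apply: cvgB; [exact: cvg_snd|exact: cvg_cst]].
by apply: cvgM; [exact: cw|apply: cvgB; [exact: cvg_fst|exact: cvg_cst]].
Qed.

Lemma energy_density_vortex C K Rc eps c z (a b : R) : 0 < eps -> eps ^+ 2 < sqd c z ->
  energy_density C K Rc (a *: vortex_field eps c z) (b *: vortex_field eps c z) =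
  2^-1 * (C * a ^+ 2 + K * b ^+ 2 + 2 * Rc * a * b) * vortex_weight eps c z.
Proof.
move=> e0 h; have s0 : sqd c z != 0 by rewrite gt_eqF// (lt_trans _ h)// exprn_gt0.
have E : vortex_weight eps c z ^+ 2 * sqd c z = vortex_weight eps c z.
  by rewrite vortex_weightE// expr2 -mulrA mulVf// mulr1.
rewrite -[in RHS]E /energy_density /dot /vortex_field /= /GRing.scale/=.
by rewrite [sqd c z in RHS]/sqd; field.
Qed.

Lemma integral_vortex_weight_le (D : set (plane R)) eps c (M : R) : measurable D ->
  0 < eps -> eps < M -> (forall z, D z -> eps ^+ 2 < sqd c z <= M ^+ 2) ->
  (\int[leb2]_(z in D) (vortex_weight eps c z)%:E <= (2 * pi * (ln M - ln eps))%:E)%E.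
Proof.
move=> mD e0 eM hD.
have M0 : 0 < M by exact: lt_trans eM.
have e2 : 0 < eps ^+ 2 by rewrite exprn_gt0.
have e2M : eps ^+ 2 < M ^+ 2 by rewrite ltrXn2r// ?nnegrE ltW.
pose psi (s : R) : \bar R := ((fun s => s^-1%:E) \_ `[eps ^+ 2, M ^+ 2]) s.
have cinv : {within `[eps ^+ 2, M ^+ 2], continuous (fun s : R => s^-1)}.
  apply: continuous_in_subspaceT => s; rewrite inE/= in_itv/= => /andP[hs _].
  by apply: cvgV; [rewrite gt_eqF// (lt_le_trans e2)|exact: cvg_id].
have mpsi : measurable_fun [set: R] psi.
  apply/(measurable_restrictT _ _).1 => //; apply/measurable_EFinP.
  exact: subspace_continuous_measurable_fun.
have psi0 s : (0 <= psi s)%E.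
  rewrite /psi patchE; case: ifPn => //; rewrite inE/= in_itv/= => /andP[hs _].
  by rewrite lee_fin invr_ge0 (le_trans (ltW e2)).
apply: (@le_trans _ _ (\int[leb2]_z psi (sqd c z))%E).
  apply: (@le_trans _ _ (\int[leb2]_(z in D) psi (sqd c z))%E).
    rewrite le_eqVlt; apply/orP; left; apply/eqP; apply: eq_integral => z.
    rewrite inE => /hD /andP[h1 h2]; rewrite vortex_weightE// /psi patchE mem_set//=.
    by rewrite in_itv/= (ltW h1).
  apply: ge0_subset_integral => //.
  exact: (measurableT_comp mpsi (measurable_sqd c)).
rewrite (integral_radial c mpsi psi0).
rewrite (@integral_support _ _ _ _ (`[eps ^+ 2, M ^+ 2]%classic : set (measurableTypeR R)) `[0%R, +oo[%classic)//.
- have dln (x : R) : eps ^+ 2 <= x <= M ^+ 2 -> is_derive x 1 (@ln R) x^-1.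
    by move=> /andP[hx _]; apply: is_derive1_ln; exact: lt_le_trans hx.
  have Ip : (\int[@lebesgue_measure R]_(x in `[(eps ^+ 2)%R, (M ^+ 2)%R]) psi x =
      (ln (M ^+ 2) - ln (eps ^+ 2))%:E)%E.
    rewrite -(FTC_is_derive e2M dln cinv).
    by apply: eq_integral => s hs; rewrite /psi patchE hs.
  rewrite [X in (_ * X)%E]Ip -EFinM lee_fin.
  rewrite !lnXn// le_eqVlt; apply/orP; left; apply/eqP.
  by rewrite -(mulr_natl (ln M)) -(mulr_natl (ln eps)); ring.
- by move=> s; rewrite /= !in_itv/= andbT => /andP[h _]; exact: le_trans (ltW e2) h.
- by move=> s _ hs; rewrite /psi patchE memNset.
Qed.

End Vortex.

Section UpperBound.
Context {R : realType}.
Variables (Om : set (R * R)) (N : nat) (d : 'I_N -> R * R).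
Variable (eps0 : R).
Hypotheses (Om_open : open Om) (Om_bounded : bounded_set Om) (eps0_gt0 : 0 < eps0).
Hypotheses (disks_disj : forall i j, i != j ->
       disk (d i) eps0 `&` disk (d j) eps0 = set0)
  (disks_Om : forall i, disk (d i) eps0 `<=` Om).

(** A vortex field has circulation 2 pi around its centre, whence the
    normalization. *)
Definition superposition (b : 'I_N -> R) (eps : R) (z : R * R) : R * R :=
  (\sum_i b i / (2 * pi) * (vortex_field eps (d i) z).1,
   \sum_i b i / (2 * pi) * (vortex_field eps (d i) z).2).

Lemma vortex_sum_bound (P : pred 'I_N) (b : 'I_N -> R) (v : 'I_N -> R) (r : R) :
  (forall i, P i -> `|v i| <= r) -> 0 <= r ->
  `|\sum_(i | P i) b i / (2 * pi) * v i| <= (\sum_i `|b i / (2 * pi)|) * r.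
Proof.
move=> hv r0; apply: (le_trans (ler_norm_sum _ _ _)); rewrite mulr_suml.
rewrite big_mkcond/=; apply: ler_sum => i _; case: ifPn => [Pi|_].
  by rewrite normrM; apply: ler_wpM2l => //; exact: hv.
by rewrite mulr_ge0.
Qed.

Lemma L2v_superposition b eps : 0 < eps -> L2v Om (superposition b eps).
Proof.
move=> e0; have mOm := measurable_Om Om_open; have Omoo := leb2_Om_lty Om_open Om_bounded.
have bd i z : `|(vortex_field eps (d i) z).1| <= eps^-1 /\
              `|(vortex_field eps (d i) z).2| <= eps^-1.
  by apply: vortex_field_bound => //; rewrite le_max lexx orbT.
split; apply: (@L2_bounded _ _ _ ((\sum_i `|b i / (2 * pi)|) * eps^-1)) => //.
- apply: measurable_funTS; apply: measurable_sum => i.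
  by apply: measurable_funM => //; exact: (measurable_vortex_field (d i) e0).1.
- move=> z _; apply: vortex_sum_bound; last by rewrite invr_ge0 ltW.
  by move=> i _; exact: (bd i z).1.
- apply: measurable_funTS; apply: measurable_sum => i.
  by apply: measurable_funM => //; exact: (measurable_vortex_field (d i) e0).2.
- move=> z _; apply: vortex_sum_bound; last by rewrite invr_ge0 ltW.
  by move=> i _; exact: (bd i z).2.
Qed.

Lemma L2v_sub (A B : set (plane R)) f : measurable A -> measurable B -> B `<=` A ->
  L2v A f -> L2v B f.
Proof.
move=> mA mB BA.
have sub g : L2 A g -> L2 B g.
  move=> [mg ig]; split; first exact: (measurable_funS mA BA mg).
  exact: integrableS ig.
by move=> [f1 f2]; split; exact: sub.
Qed.

(** Each vortex contributes the flux computed in flux_cst_disk, because the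
    gradient of phi vanishes off the perforated domain. With all constants 0 this is
    the absence of curl, with one constant 1 and the others 0 the circulation. *)
Lemma circulation_superposition b eps phi (cj : 'I_N -> R) : 0 < eps ->
  test_function Om phi ->
  (forall j z, disk (d j) eps z -> phi z = cj j) ->
  leb2.-integrable (perforated Om d eps) (fun z =>
    ((superposition b eps z).1 * dy phi z - (superposition b eps z).2 * dx phi z)%:E) /\
  \int[leb2]_(z in perforated Om d eps)
    ((superposition b eps z).1 * dy phi z - (superposition b eps z).2 * dx phi z)
  = \sum_j b j * cj j.
Proof.
move=> e0 [kphi cphi sphi] phic.
set Ome := perforated Om d eps.
have mOme : measurable (Ome : set (plane R)) by apply: measurable_perforated => //; exact: ltW.
have phi0 z : ~ Om z -> phi z = 0.
  move=> Oz; apply: contrapT => /eqP h; apply: Oz; apply: sphi.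
  exact: subset_closure.
have [M M0 hM] := bounded_set_box Om_bounded.
have phiM z : M < `|z.1| \/ M < `|z.2| -> phi z = 0.
  move=> hz; apply: phi0 => /hM[h1 h2].
  by case: hz; rewrite ltNge ?h1 ?h2.
have A0 : 0 < eps ^+ 2 by rewrite exprn_gt0.
have phid j z : sqd (d j) z <= eps ^+ 2 -> phi z = cj j.
  by move=> h; apply: phic; rewrite disk_sqd// ltW.
have grad0 z : ~ Ome z -> dx phi z = 0 /\ dy phi z = 0.
  move=> hz; have [Oz|nOz] := pselect (Om z).
    have : (\bigcup_i disk (d i) eps) z by apply: contrapT => h; exact: hz.
    move=> [j _]; rewrite disk_sqd ?ltW//= => hj.
    exact: (grad_cst_disk A0 (kphi 1) (phid j) hj).
  have nz : \forall y \near z, phi y = 0.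
    have : nbhs z (~` closure [set z | phi z != 0]).
      apply: open_nbhs_nbhs; split; first exact/closed_openC/closed_closure.
      by move/sphi.
    apply: filterS => y hy; apply: contrapT => /eqP h; apply: hy.
    exact: subset_closure.
  by split; [exact: dx_near_cst nz|exact: dy_near_cst nz].
pose E j z := ((z.1 - (d j).1) * dx phi z + (z.2 - (d j).2) * dy phi z) / sqd (d j) z.
have IE j : leb2.-integrable Ome (EFin \o E j) /\
    (\int[leb2]_(z in Ome) (E j z)%:E = (- (2 * pi * cj j))%:E)%E.
  have [iE <-] := flux_cst_disk A0 (ltW M0) kphi (phid j) phiM.
  split; first by apply: integrableS iE.
  apply/esym; apply: integral_support => // z _ hz.
  by rewrite (grad0 z hz).1 (grad0 z hz).2 !mulr0 addr0 mul0r.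
have EE z : Ome z -> (superposition b eps z).1 * dy phi z - (superposition b eps z).2 * dx phi z =
    \sum_j (- (b j / (2 * pi))) * E j z.
  move=> Oz; rewrite /superposition /= !mulr_suml -sumrB; apply: eq_bigr => j _.
  rewrite vortex_weightE; last by apply: perforated_sqd Oz; exact: ltW.
  by rewrite /E; move: (b j / _) (sqd _ _)^-1 => x y; ring.
have iS : leb2.-integrable Ome (fun z => (\sum_j (- (b j / (2 * pi))) * E j z)%:E).
  under eq_fun do rewrite -sumEFin.
  apply: integrable_sum => // j _; under eq_fun do rewrite EFinM.
  by apply: integrableZl => //; case: (IE j).
split.
  by apply: eq_integrable iS => // z; rewrite inE => Oz; rewrite EE.
rewrite (@eq_Rintegral _ _ _ leb2 _ (fun z => \sum_j (- (b j / (2 * pi))) * E j z)); last first.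
  by move=> z; rewrite inE => Oz; rewrite EE.
rewrite /Rintegral; under eq_integral do rewrite -sumEFin.
rewrite integral_sum//; last first.
  move=> j; under eq_fun do rewrite EFinM.
  by apply: integrableZl => //; case: (IE j).
rewrite (eq_bigr (fun j => (b j * cj j)%:E)); first by rewrite sumEFin.
move=> j _; under eq_integral do rewrite EFinM.
have [ij Ij] := IE j.
rewrite integralZl// Ij -EFinM; congr EFin.
by have := @pi_gt0 R; move: (@pi R) => p p0; field; rewrite lt0r_neq0.
Qed.

Lemma H0eps_superposition bu bw eps : 0 < eps ->
  H0eps Om d bu bw eps (superposition bu eps) (superposition bw eps).
Proof.
move=> e0.
have mOme : measurable (perforated Om d eps : set (plane R)).
  by apply: measurable_perforated => //; exact: ltW.
have sub := @perforated_sub R Om N d eps.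
have L b : L2v (perforated Om d eps) (superposition b eps).
  exact: L2v_sub (measurable_Om Om_open) mOme sub (L2v_superposition b e0).
have curl b : curl_free (perforated Om d eps) (superposition b eps).
  move=> phi [kphi cphi sphi].
  have tphi : test_function Om phi by split => //; exact: subset_trans sphi sub.
  have phi0 (j : 'I_N) z : disk (d j) eps z -> phi z = 0.
    move=> hz; apply: contrapT => /eqP h.
    have [_] := sphi _ (subset_closure (h : [set z | phi z != 0] z)).
    by apply; exists j.
  have [iS IS] := circulation_superposition b e0 tphi (cj := fun=> 0) phi0.
  rewrite (@eq_Rintegral _ _ _ leb2 _ (fun z => -1 * ((superposition b eps z).1 * dy phi z -
    (superposition b eps z).2 * dx phi z))); last by move=> z _; ring.
  rewrite RintegralZl// IS big1 ?mulr0// => j _; exact: mulr0.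
have circ b i : circulation Om d eps (superposition b eps) i (b i).
  move=> phi tphi phij.
  have [_ ->] := circulation_superposition b e0 tphi (cj := fun j => (i == j)%:R) phij.
  rewrite (bigD1 i)//= eqxx mulr1 big1 ?addr0// => j ji.
  by rewrite eq_sym (negbTE ji) mulr0.
by split; [split; exact: L|split; exact: curl|exact: circ|exact: circ].
Qed.

Variables (bu bw : 'I_N -> R) (C K Rc : R).
Hypotheses (C_gt0 : 0 < C) (K_gt0 : 0 < K) (CKR : Rc ^+ 2 < C * K).

Let coef i := C * bu i ^+ 2 + K * bw i ^+ 2 + 2 * Rc * bu i * bw i.

(** At most one vortex is at distance less than eps0 from z; all the others add up
    to a bounded field, which energy_density_split separates from the first at the
    cost of the factor 1 + eta. *)
Lemma energy_density_superposition (eta : R) : 0 < eta -> exists c0 : R, forall eps z,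
  0 < eps -> eps < eps0 -> perforated Om d eps z ->
  energy_density C K Rc (superposition bu eps z) (superposition bw eps z) <=
  (1 + eta) * (\sum_i coef i / (8 * pi ^+ 2) * vortex_weight eps (d i) z) + c0.
Proof.
move=> eta0.
pose m := (\sum_i `|bu i / (2 * pi)| + \sum_i `|bw i / (2 * pi)|) * eps0^-1.
pose c1 := (C + K + 2 * `|Rc|) * m ^+ 2.
exists ((1 + eta^-1) * c1) => eps z e0 ee0 Oz.
have far i : eps0 ^+ 2 <= sqd (d i) z ->
    `|(vortex_field eps (d i) z).1| <= eps0^-1 /\ `|(vortex_field eps (d i) z).2| <= eps0^-1.
  by move=> h; apply: vortex_field_bound => //; rewrite le_max h.
have si i := perforated_sqd i (ltW e0) Oz.
have coef0 i : 0 <= coef i by exact: quadratic_ge0.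
have pi0 := @pi_gt0 R.
have e0V : 0 <= eps0^-1 by rewrite invr_ge0 ltW.
have rest (P : pred 'I_N) : (forall i, P i -> eps0 ^+ 2 <= sqd (d i) z) ->
    energy_density C K Rc
     (\sum_(i | P i) bu i / (2 * pi) * (vortex_field eps (d i) z).1,
      \sum_(i | P i) bu i / (2 * pi) * (vortex_field eps (d i) z).2)
     (\sum_(i | P i) bw i / (2 * pi) * (vortex_field eps (d i) z).1,
      \sum_(i | P i) bw i / (2 * pi) * (vortex_field eps (d i) z).2) <= c1.
  move=> hP; have f1 i (Pi : P i) := (far i (hP i Pi)).1.
  have f2 i (Pi : P i) := (far i (hP i Pi)).2.
  have s0 (b : 'I_N -> R) : 0 <= \sum_i `|b i / (2 * pi)| by apply: sumr_ge0.
  by apply: energy_density_bounded => //=; rewrite ?/m;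
    (apply: le_trans (vortex_sum_bound _ f1 e0V) _ || apply: le_trans (vortex_sum_bound _ f2 e0V) _);
    apply: ler_wpM2r => //; rewrite ?lerDl ?lerDr.
have c10 : 0 <= c1.
  by rewrite mulr_ge0 ?sqr_ge0// !addr_ge0 ?mulr_ge0// ltW.
have eta1 : 1 <= 1 + eta^-1 by rewrite lerDl invr_ge0 ltW.
have term0 i : 0 <= coef i / (8 * pi ^+ 2) * vortex_weight eps (d i) z.
  rewrite mulr_ge0 ?(ltW (vortex_weight_gt0 _ _ _))// divr_ge0// mulr_ge0// exprn_ge0//.
  exact: ltW.
have [[i iz]|none] := pselect (exists i, sqd (d i) z <= eps0 ^+ 2); last first.
  apply: (@le_trans _ _ c1).
    apply: (rest predT) => i _; rewrite leNgt; apply/negP => h; apply: none.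
    by exists i; exact: ltW.
  apply: (@le_trans _ _ ((1 + eta^-1) * c1)); first by rewrite ler_peMl.
  by rewrite lerDr mulr_ge0 ?sumr_ge0// addr_ge0// ltW.
pose F (b : 'I_N -> R) : R * R :=
  (\sum_(j | j != i) b j / (2 * pi) * (vortex_field eps (d j) z).1,
   \sum_(j | j != i) b j / (2 * pi) * (vortex_field eps (d j) z).2).
have sE b : superposition b eps z = (b i / (2 * pi)) *: vortex_field eps (d i) z + F b.
  by rewrite /superposition (bigD1 i)//= [X in (_, X)](bigD1 i).
rewrite !sE; apply: (le_trans (energy_density_split _ _ _ _ C_gt0 CKR eta0)).
apply: lerD; last first.
  apply: ler_wpM2l; first by rewrite (le_trans _ eta1).
  apply: (rest (fun j => j != i)) => j ji; apply: ltW.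
  by apply: (disk_far eps0_gt0 disks_disj _ iz); rewrite eq_sym.
apply: ler_wpM2l; first by rewrite addr_ge0// ltW.
rewrite energy_density_vortex// (bigD1 i)//=.
have -> : 2^-1 * (C * (bu i / (2 * pi)) ^+ 2 + K * (bw i / (2 * pi)) ^+ 2 +
    2 * Rc * (bu i / (2 * pi)) * (bw i / (2 * pi))) = coef i / (8 * pi ^+ 2).
  by rewrite /coef; move: (@pi R) pi0 => p p0; field; rewrite lt0r_neq0.
by rewrite lerDl sumr_ge0.
Qed.

(** The integral of 1 / |z - d i|^2 over a ring of radii eps and M is
    2 pi (ln M - ln eps); everything else in energy_density_superposition is
    bounded. *)
Lemma energy_upper (eta : R) : 0 < eta -> exists c1 : R, forall eps, 0 < eps -> eps < eps0 ->
  (energy C K Rc (perforated Om d eps) (superposition bu eps) (superposition bw eps)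
   <= ((1 + eta) * core_energy C K Rc bu bw * - ln eps + c1)%:E)%E.
Proof.
move=> eta0; have [c0 hc0] := energy_density_superposition eta0.
have [M0 M00 hM0] := bounded_set_box Om_bounded.
have pi0 := @pi_gt0 R.
(* a common radius for disks around the d i covering Om *)
pose M := eps0 + 2 * M0 + \sum_i (`|(d i).1| + `|(d i).2|) * 2.
have dsum i : (`|(d i).1| + `|(d i).2|) * 2 <= M - eps0 - 2 * M0.
  rewrite /M addrAC addrAC (_ : _ - _ - _ = \sum_i (`|(d i).1| + `|(d i).2|) * 2); last by ring.
  by rewrite (bigD1 i)//= lerDl sumr_ge0// => j _; rewrite mulr_ge0// addr_ge0.
have eps0M : eps0 < M.
  have : 0 <= \sum_i (`|(d i).1| + `|(d i).2|) * 2.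
    by apply: sumr_ge0 => j _; rewrite mulr_ge0// addr_ge0.
  by rewrite /M; lra.
clearbody M.
have OmM i z : Om z -> sqd (d i) z <= M ^+ 2.
  move=> /hM0[h1 h2]; have hd := dsum i.
  have n1 := normr_ge0 (d i).1; have n2 := normr_ge0 (d i).2.
  have a1 : `|z.1 - (d i).1| <= M0 + `|(d i).1| by apply: (le_trans (ler_normB _ _)); lra.
  have a2 : `|z.2 - (d i).2| <= M0 + `|(d i).2| by apply: (le_trans (ler_normB _ _)); lra.
  rewrite /sqd -[(z.1 - _) ^+ 2]real_normK ?num_real// -[(z.2 - _) ^+ 2]real_normK ?num_real//.
  have m1 := normr_ge0 (z.1 - (d i).1); have m2 := normr_ge0 (z.2 - (d i).2).
  have hs : `|z.1 - (d i).1| + `|z.2 - (d i).2| <= M.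
    by move: hd n1 n2 a1 a2 eps0_gt0; lra.
  move: `|z.1 - _| `|z.2 - _| m1 m2 hs => x y x0 y0 hs.
  have := lerXn2r 2 _ _ hs; rewrite !nnegrE => /(_ ltac:(lra) ltac:(lra)).
  have := mulr_ge0 x0 y0; nra.
pose c1 := (1 + eta) * core_energy C K Rc bu bw * ln M + `|c0| * fine (leb2 Om).
exists c1 => eps e0 ee0.
set Ome := perforated Om d eps.
have mOm := measurable_Om Om_open; have Omoo := leb2_Om_lty Om_open Om_bounded.
have mOme : measurable (Ome : set (plane R)) by apply: measurable_perforated => //; exact: ltW.
have Omeoo : (leb2 Ome < +oo)%E by apply: leb2_perforated_lty => //; exact: ltW.
have coef0 i : 0 <= coef i by exact: quadratic_ge0.
pose ci i := (1 + eta) * (coef i / (8 * pi ^+ 2)).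
have ci0 i : 0 <= ci i.
  rewrite mulr_ge0 ?addr_ge0 ?(ltW eta0)// divr_ge0// mulr_ge0// exprn_ge0//.
  exact: ltW.
have iv i : leb2.-integrable Ome (fun z => (vortex_weight eps (d i) z)%:E).
  apply: (integrable_le_cst (c := eps ^- 2)) => //.
    by apply: measurable_funTS; apply: continuous_measurable_plane; exact: continuous_vortex_weight.
  move=> z _; rewrite ger0_norm ?(ltW (vortex_weight_gt0 _ _ _))//.
  by rewrite lef_pV2 ?posrE ?lt_max ?exprn_gt0 ?orbT// le_max lexx orbT.
have Iv i : (\int[leb2]_(z in Ome) (vortex_weight eps (d i) z)%:E <=
    (2 * pi * (ln M - ln eps))%:E)%E.
  apply: integral_vortex_weight_le => //; first exact: lt_trans eps0M.
  move=> z Oz; rewrite (perforated_sqd i (ltW e0) Oz)/=.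
  by apply: OmM; exact: perforated_sub Oz.
have iS : leb2.-integrable Ome (fun z => (\sum_i ci i * vortex_weight eps (d i) z)%:E).
  under eq_fun do rewrite -sumEFin.
  apply: integrable_sum => // i _; under eq_fun do rewrite EFinM.
  exact: integrableZl.
have ic : leb2.-integrable Ome (fun z => `|c0|%:E).
  by apply: (integrable_le_cst (c := `|c0|)) => // z _; rewrite normr_id.
rewrite energyE; apply: (@le_trans _ _
  (\int[leb2]_(z in Ome) ((\sum_i ci i * vortex_weight eps (d i) z)%:E + `|c0|%:E))%E).
  have L b : L2v Ome (superposition b eps).
    by apply: (L2v_sub mOm mOme _ (L2v_superposition b e0)); exact: perforated_sub.
  apply: le_integral => //.
  - exact: integrable_edens.
  - exact: integrableD.
  - move=> z; rewrite inE => Oz; rewrite -EFinD lee_fin.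
    apply: (le_trans (hc0 eps z e0 ee0 Oz)).
    rewrite mulr_sumr; apply: lerD; last exact: ler_norm.
    by apply: ler_sum => i _; rewrite /ci mulrA.
rewrite integralD//; under eq_integral do rewrite -sumEFin.
rewrite integral_sum//; last first.
  by move=> i; under eq_fun do rewrite EFinM; exact: integrableZl.
rewrite integral_cst//.
have -> : (1 + eta) * core_energy C K Rc bu bw * - ln eps + c1 =
    (\sum_i ci i * (2 * pi * (ln M - ln eps))) + `|c0| * fine (leb2 Om).
  rewrite /c1 addrA -mulrDr; congr (_ + _); rewrite core_energyE -/coef.
  rewrite -mulrA mulr_suml mulr_sumr; apply: eq_bigr => i _.
  rewrite /ci -/(coef i); move: (coef i) (@pi R) pi0 => q p p0.
  by field; rewrite lt0r_neq0.
rewrite EFinD; apply: leeD.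
  rewrite -sumEFin; apply: lee_sum => i _; under eq_integral do rewrite EFinM.
  rewrite integralZl// (EFinM (ci i)).
  by apply: lee_wpmul2l; [rewrite lee_fin|exact: Iv].
rewrite EFinM fineK; last by rewrite ge0_fin_numE.
apply: lee_wpmul2l; first by rewrite lee_fin.
by apply: le_measure; rewrite ?inE//; exact: perforated_sub.
Qed.

End UpperBound.

(** * The rescaled energies and their infima *)

Section Rescaled.
Context {R : realType}.
Variables (Om : set (R * R)) (N : nat) (d : 'I_N -> R * R) (bu bw : 'I_N -> R).
Variables (C K Rc eps0 : R).
Hypotheses (Om_open : open Om) (Om_bounded : bounded_set Om).
Hypotheses (C_gt0 : 0 < C) (K_gt0 : 0 < K) (CKR : Rc ^+ 2 < C * K).
Hypotheses (eps0_gt0 : 0 < eps0) (eps0_lt1 : eps0 < 1).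
Hypotheses (disks_disj : forall i j, i != j ->
       disk (d i) eps0 `&` disk (d j) eps0 = set0)
  (disks_Om : forall i, disk (d i) eps0 `<=` Om).

Let E0 := core_energy C K Rc bu bw.
Let J := Jeps C K Rc Om d bu bw.

Lemma core_energy_ge0 : 0 <= E0.
Proof.
apply: sumr_ge0 => i _; apply: divr_ge0; first exact: quadratic_ge0.
by rewrite mulr_ge0// pi_ge0.
Qed.

Lemma energy_density_scale (s : R) (p q : R * R) :
  energy_density C K Rc (s *: p) (s *: q) = s ^+ 2 * energy_density C K Rc p q.
Proof. by rewrite /energy_density /dot /= /GRing.scale/=; field. Qed.

Lemma scale_sqr eps : 0 < eps -> eps < eps0 ->
  0 < - ln eps /\ (Num.sqrt `|ln eps|)^-1 ^+ 2 = (- ln eps)^-1.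
Proof.
move=> e0 ee0.
have l0 : ln eps < 0 by rewrite ln_lt0// e0 (lt_trans ee0).
split; first by rewrite oppr_gt0.
by rewrite exprVn sqr_sqrtr// ltr0_norm.
Qed.

Lemma L2v_scale (D : set (plane R)) (s : R) f : measurable D -> L2v D f ->
  L2v D (fun z => s *: f z).
Proof.
move=> mD.
have sc g : L2 D g -> L2 D (fun z => s * g z).
  move=> [mg ig]; split.
    exact: (@measurable_funM _ (plane R) R D (cst s) g (measurable_cst s) mg).
  have := integrableZl mD (s ^+ 2) ig.
  by apply: eq_integrable => // z _ /=; rewrite -EFinM exprMn.
by move=> [f1 f2]; split; exact: sc.
Qed.

Lemma energy_scale (D : set (plane R)) (s : R) f g : measurable D ->
  L2v D f -> L2v D g ->
  energy C K Rc D (fun z => s *: f z) (fun z => s *: g z) =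
  ((s ^+ 2)%:E * energy C K Rc D f g)%E.
Proof.
move=> mD Lf Lg; rewrite !energyE -integralZl//; last exact: integrable_edens.
by apply: eq_integral => z _; rewrite energy_density_scale EFinM.
Qed.

(** If the energy were e < X, with X the claimed bound, then eta = (X - e) / (2 X) in
    energy_lower would give the lower bound (X + e) / 2 > e. *)
Lemma energy_lower_lim eps f g : 0 < eps -> eps < eps0 ->
  H0eps Om d bu bw eps f g ->
  (((ln eps0 - ln eps) * E0)%:E <= energy C K Rc (perforated Om d eps) f g)%E.
Proof.
have frac (x y : R) : 0 <= y -> y < x -> 0 < (x - y) / (2 * x) < 1.
  move=> y0 yx; have x0 : 0 < x by exact: le_lt_trans yx.
  apply/andP; split; first by apply: divr_gt0; [rewrite subr_gt0|apply: mulr_gt0].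
  by rewrite ltr_pdivrMr ?mulr_gt0//; lra.
move=> e0 ee0 Hfg; have [[Lf Lg] _ _ _] := Hfg.
have mOme : measurable (perforated Om d eps : set (plane R)).
  by apply: measurable_perforated => //; exact: ltW.
have ie := integrable_edens C K Rc mOme Lf Lg.
have low eta h := @energy_lower R Om N d bu bw C K Rc eps0 Om_open Om_bounded C_gt0 CKR
  eps0_gt0 disks_disj disks_Om eps f g eta e0 ee0 h Hfg.
rewrite energyE in low *.
have fe := integrable_fin_num mOme ie.
have e_ge0 : (0 <= \int[leb2]_(z in perforated Om d eps) (energy_density C K Rc (f z) (g z))%:E)%E.
  by apply: integral_ge0 => z _; rewrite lee_fin; exact: energy_density_ge0.
rewrite -(fineK fe) lee_fin; rewrite -(fineK fe) lee_fin in e_ge0.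
set e := fine _ in e_ge0 *; set X := _ * E0.
rewrite leNgt; apply/negP => eX.
have X0 : 0 < X by exact: le_lt_trans eX.
pose eta := (X - e) / (2 * X).
have etaX : eta * X = (X - e) / 2 by rewrite /eta; field; rewrite gt_eqF.
have h : 0 < eta < 1 by exact: frac.
have := low eta h; rewrite -(fineK fe) lee_fin -mulrA -/X -/e mulrBl mul1r etaX.
by lra.
Qed.

Lemma Jeps_lower eps U W : 0 < eps -> eps < eps0 -> L2v Om U -> L2v Om W ->
  (((ln eps0 - ln eps) * E0 / - ln eps)%:E <= J eps U W)%E.
Proof.
move=> e0 ee0 LU LW; rewrite /J /Jeps; case: asboolP => [|_]; last exact: leey.
move=> [ft [gt [Hfg Uft Wgt]]].
have [l0 s2] := scale_sqr e0 ee0.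
set s := (_)^-1 in Uft Wgt s2.
have mOme : measurable (perforated Om d eps : set (plane R)).
  by apply: measurable_perforated => //; exact: ltW.
have mOm := measurable_Om Om_open.
have sub := @perforated_sub R Om N d eps.
have [[Lf Lg] _ _ _] := Hfg.
have -> : energy C K Rc (perforated Om d eps) U W =
    energy C K Rc (perforated Om d eps) (fun z => s *: ft z) (fun z => s *: gt z).
  rewrite !energyE; apply: ge0_ae_eq_integral => //.
  - exact: (measurable_int leb2 (integrable_edens _ _ _ mOme (L2v_sub mOm mOme sub LU) (L2v_sub mOm mOme sub LW))).
  - exact: (measurable_int leb2 (integrable_edens _ _ _ mOme (L2v_scale s mOme Lf) (L2v_scale s mOme Lg))).
  - by move=> z _; rewrite lee_fin; exact: energy_density_ge0.
  - by move=> z _; rewrite lee_fin; exact: energy_density_ge0.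
  - apply: (@filterS2 _ _ (ae_filter_ringOfSetsType (@leb2 R)) _ _ _ _ Uft Wgt).
    by move=> z /= hU hW Oz; rewrite hU// hW.
rewrite energy_scale// s2 mulrC EFinM; apply: lee_wpmul2l.
  by rewrite lee_fin invr_ge0 ltW.
exact: energy_lower_lim.
Qed.

Lemma Jeps_upper (eta : R) : 0 < eta -> exists c1 : R, forall eps,
  0 < eps -> eps < eps0 -> exists UW : (R * R -> R * R) * (R * R -> R * R),
  [/\ L2v Om UW.1, L2v Om UW.2 &
    (J eps UW.1 UW.2 <= ((1 + eta) * E0 + c1 / - ln eps)%:E)%E].
Proof.
move=> eta0.
have [c1 hc1] := energy_upper Om_open Om_bounded eps0_gt0 disks_disj bu bw C_gt0 K_gt0 CKR eta0.
exists c1 => eps e0 ee0; have [l0 s2] := scale_sqr e0 ee0.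
have mOme : measurable (perforated Om d eps : set (plane R)).
  by apply: measurable_perforated => //; exact: ltW.
have mOm := measurable_Om Om_open.
have sub := @perforated_sub R Om N d eps.
have L b : L2v Om (superposition d b eps) by exact: L2v_superposition.
set s := (Num.sqrt `|ln eps|)^-1 in s2.
exists (fun z => s *: superposition d bu eps z, fun z => s *: superposition d bw eps z).
split; [exact: L2v_scale|exact: L2v_scale|].
rewrite /J /Jeps; case: asboolP => [_|[]]; last first.
  exists (superposition d bu eps), (superposition d bw eps); split.
  - exact: H0eps_superposition.
  - by apply: (@aeW _ (plane R) R leb2).
  - by apply: (@aeW _ (plane R) R leb2).
rewrite /= energy_scale//; [|exact: L2v_sub mOm mOme sub (L _)..].
rewrite s2 (_ : (1 + eta) * E0 + c1 / - ln eps =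
  (- ln eps)^-1 * ((1 + eta) * E0 * - ln eps + c1)); last first.
  by move: (- ln eps) l0 => l l0; field; rewrite lt0r_neq0.
rewrite EFinM; apply: lee_wpmul2l; first by rewrite lee_fin invr_ge0 ltW.
exact: hc1.
Qed.

(** Both bounds differ from E0 by a term of order 1 / |ln eps|, and the upper one
    in addition by eta E0 with eta arbitrary. *)
Lemma inf_Jeps_cvg :
  let m eps := ereal_inf [set J eps UW.1 UW.2 |
    UW in [set UW | L2v Om UW.1 /\ L2v Om UW.2]] in
  (forall eps, 0 < eps -> eps < eps0 -> m eps \is a fin_num) /\
  fine (m eps) - E0 @[eps --> 0^'+] --> 0.
Proof.
move=> m.
have low eps : 0 < eps -> eps < eps0 ->
    (((ln eps0 - ln eps) * E0 / - ln eps)%:E <= m eps)%E.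
  move=> e0 ee0; apply/ereal_infP => _ [[U W] [LU LW] <-].
  exact: Jeps_lower.
have up eta : 0 < eta -> exists c1, forall eps, 0 < eps -> eps < eps0 ->
    (m eps <= ((1 + eta) * E0 + c1 / - ln eps)%:E)%E.
  move=> eta0; have [c1 hc1] := Jeps_upper eta0; exists c1 => eps e0 ee0.
  have [UW [LU LW hJ]] := hc1 eps e0 ee0.
  by apply: ge_ereal_inf; exists (J eps UW.1 UW.2) => //; exists UW.
have mfin eps : 0 < eps -> eps < eps0 -> m eps \is a fin_num.
  move=> e0 ee0; have [c1 hc1] := up 1 ltr01.
  rewrite fin_numElt (lt_le_trans (ltNyr _) (low eps e0 ee0))//=.
  exact: le_lt_trans (hc1 eps e0 ee0) (ltry _).
split=> //; have E0_ge0 := core_energy_ge0.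
apply/cvgr0Pnorm_lt => e e_gt0.
pose eta := e / (2 * (E0 + 1)).
have eta0 : 0 < eta by rewrite divr_gt0// mulr_gt0// ltr_wpDl.
have etaE : eta * E0 <= e / 2.
  have -> : e / 2 = eta * (E0 + 1) by rewrite /eta; field; rewrite gt_eqF// ltr_wpDl.
  by rewrite ler_pM2l// lerDl.
have [c1 hc1] := up eta eta0.
pose T := (2 * `|c1| + E0 * `|ln eps0|) / e + 1.
near=> eps.
have e0 : 0 < eps by near: eps; exact: nbhs_right_gt.
have ee0 : eps < eps0 by near: eps; exact: nbhs_right_lt.
have eT : eps < expR (- T) by near: eps; apply: nbhs_right_lt; exact: expR_gt0.
have [l0 _] := scale_sqr e0 ee0.
have lT : T < - ln eps by rewrite ltrNr -ltr_expR lnK.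
have := low eps e0 ee0; have := hc1 eps e0 ee0.
rewrite -(fineK (mfin eps e0 ee0)) !lee_fin; move: (fine _) => mm.
have hl0 : 0 < - ln eps by [].
have hT : 2 * `|c1| + E0 * `|ln eps0| < e * - ln eps.
  rewrite -ltr_pdivrMl// mulrC; apply: lt_trans lT; rewrite /T ltrDl.
  exact: ltr01.
have cc : c1 / - ln eps < e / 2.
  rewrite ltr_pdivrMr//; have := ler_norm c1.
  have : 0 <= E0 * `|ln eps0| by rewrite mulr_ge0.
  by lra.
have ll : - (E0 * `|ln eps0|) / - ln eps > - e.
  rewrite ltr_pdivlMr//; have := normr_ge0 c1; lra.
move=> /= up1 low1; rewrite ltr_norml; apply/andP; split; last by lra.
have low2 : E0 - (E0 * `|ln eps0|) / - ln eps <= (ln eps0 - ln eps) * E0 / - ln eps.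
  have -> : (ln eps0 - ln eps) * E0 / - ln eps = E0 + ln eps0 * E0 / - ln eps.
    by field; rewrite lt_eqF// -oppr_gt0.
  rewrite lerD2l -mulNr ler_pM2r ?invr_gt0// [ln eps0 * _]mulrC -mulrN.
  by rewrite ler_wpM2l// lerNl -normrN ler_norm.
rewrite mulNr in ll; lra.
Unshelve. all: by end_near. Qed.

End Rescaled.

Section LimitEnergy.
Context {R : realType}.

Lemma L2v_zero (Om : set (plane R)) : measurable Om -> (leb2 Om < +oo)%E ->
  L2v Om (fun=> 0 : R * R).
Proof.
move=> mOm Omoo; have L0 : L2 Om (fun=> 0 : R).
  by apply: (@L2_bounded _ _ _ 0) => // z _; rewrite normr0.
by split; exact: L0.
Qed.

Lemma weak_grad_zero (Om : set (R * R)) : weak_grad Om (fun=> 0) (fun=> 0).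
Proof.
have I0 h : (forall z, h z = 0) -> \int[leb2]_(z in Om) (h z : R) = 0.
  by move=> h0; rewrite /Rintegral integral0_eq// => z _; rewrite h0.
by move=> phi _; split; rewrite !I0 ?oppr0// => z; rewrite mul0r.
Qed.

(** The energy is nonnegative, and it vanishes for the gradients of the constant
    functions 0. *)
Lemma inf_J0 (Om : set (R * R)) (N : nat) (bu bw : 'I_N -> R) (C K Rc : R) :
  open Om -> bounded_set Om -> 0 < C -> Rc ^+ 2 < C * K ->
  ereal_inf [set J0 C K Rc Om bu bw UW.1 UW.2 |
             UW in [set UW | L2v Om UW.1 /\ L2v Om UW.2]]
    = (core_energy C K Rc bu bw)%:E.
Proof.
move=> Om_open Om_bounded C_gt0 CKR.
have mOm := measurable_Om Om_open; have Omoo := leb2_Om_lty Om_open Om_bounded.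
have L0 := L2v_zero mOm Omoo.
apply/eqP; rewrite eq_le; apply/andP; split; last first.
  apply/ereal_infP => _ [[U W] [LU LW] <-]; rewrite /J0; case: asboolP => _; last exact: leey.
  rewrite leeDr// energyE; apply: integral_ge0 => z _.
  by rewrite lee_fin; exact: energy_density_ge0.
apply: ge_ereal_inf; exists (J0 C K Rc Om bu bw (fun=> 0) (fun=> 0)).
  by exists (fun=> 0, fun=> 0).
have H10 : H1 Om (fun=> 0).
  by split; [case: L0|exists (fun=> 0); [exact: L0|exact: weak_grad_zero]].
rewrite /J0; case: asboolP => [_|[]]; last first.
  by exists (fun=> 0), (fun=> 0); split=> //; exact: weak_grad_zero.
rewrite energyE integral0_eq ?add0e// => z _.
by rewrite /energy_density /dot /= !(mul0r, mulr0, addr0).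
Qed.

End LimitEnergy.

Theorem corollary1p3 (R : realType) (Om : set (R * R)) (N : nat)
    (d : 'I_N -> R * R) (bu bw : 'I_N -> R) (C K Rc eps0 : R)
    (Om_open : open Om) (Om_bounded : bounded_set Om)
    (Om_sc : simply_connected Om) (Om_lip : lipschitz_boundary Om)
    (N_gt0 : (0 < N)%N) (d_inj : injective d) (d_Om : forall i, Om (d i))
    (C_gt0 : 0 < C) (K_gt0 : 0 < K) (CKR : Rc ^+ 2 < C * K)
    (eps0_gt0 : 0 < eps0) (eps0_lt1 : eps0 < 1)
    (disks_disj : forall i j, i != j ->
       disk (d i) eps0 `&` disk (d j) eps0 = set0)
    (disks_Om : forall i, disk (d i) eps0 `<=` Om) :
  ereal_inf [set J0 C K Rc Om bu bw UW.1 UW.2 |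
             UW in [set UW | L2v Om UW.1 /\ L2v Om UW.2]]
    = (core_energy C K Rc bu bw)%:E /\
  exists2 o : R -> R, o eps @[eps --> 0^'+] --> 0 &
    forall eps : R, 0 < eps < eps0 -> forall U W,
      is_minimizer Om (Jeps C K Rc Om d bu bw eps) U W ->
      Jeps C K Rc Om d bu bw eps U W = (core_energy C K Rc bu bw + o eps)%:E.
Proof.
split; first exact: inf_J0.
have [mfin cvg_m] := inf_Jeps_cvg bu bw Om_open Om_bounded C_gt0 K_gt0 CKR eps0_gt0
  eps0_lt1 disks_disj disks_Om.
pose m eps := ereal_inf [set Jeps C K Rc Om d bu bw eps UW.1 UW.2 |
    UW in [set UW | L2v Om UW.1 /\ L2v Om UW.2]].
exists (fun eps => fine (m eps) - core_energy C K Rc bu bw); first exact: cvg_m.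
move=> eps /andP[e0 ee0] U W [LU LW minUW].
rewrite addrC subrK fineK; last exact: mfin.
apply/eqP; rewrite eq_le; apply/andP; split.
  by apply/ereal_infP => _ [[U' W'] [LU' LW'] <-]; exact: minUW.
by apply: ge_ereal_inf; exists (Jeps C K Rc Om d bu bw eps U W) => //; exists (U, W).
Qed.
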